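(* The multiple symmetric Fock space has the orthogonal direct sum decomposition $$\Gamma(\mathcal H)=\bigoplus_{x\in\mathcal D}[\mathcal Cx],$$ where $[\mathcal Cx]\cong\mathcal F(\mathcal K)$ for each $x\in\mathcal D$, and according to which $$\pi=\bigoplus_{x\in\mathcal D}\pi_x ,$$ where $\pi_x\cong\rho$ (unitary equivalence) for each $x\in\mathcal D$ and $\rho$ is the free Fock space representation of $\mathcal C$.
   Context: $\mathcal K=L^2(\mathbb R^+)$ with an orthonormal basis $(d_i)_{i\in\mathbb N}$, $\mathcal G$ is a separable Hilbert space with fixed orthonormal basis $(e_k)_{k\in\mathbb N}$, $\mathbb N=\{1,2,\dots\}$, $\mathcal H=\mathcal K\otimes\mathcal G$. $\Gamma(\mathcal H)=\mathbb C\Omega\oplus\bigoplus_{n\ge1}\mathcal H^{\circ n}$ is the symmetric Fock space with $u_1\circ\cdots\circ u_n=\frac1{n!}\sum_{\pi\in S_n}u_{\pi(1)}\otimes\cdots\otimes u_{\pi(n)}$, $\|\Omega\|=1$, $\langle u_1\circ\cdots\circ u_n,v_1\circ\cdots\circ v_m\rangle=\delta_{n,m}\frac1{n!}\sum_{\pi\in S_n}\prod_i\langle u_i,v_{\pi(i)}\rangle$. $\Gamma_0(\mathcal H)$ is the linear span of $\Omega$ and the vectors $(f_1\otimes e_{k_1})\circ\cdots\circ(f_n\otimes e_{k_n})$, $f_i\in\mathcal K$, $k_1\le\dots\le k_n$. Boson operators: $a^*(u)\Omega=u$, $a^*(u)\,v_1\circ\cdots\circ v_n=\sqrt{n+1}\,u\circ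 v_1\circ\cdots\circ v_n$, $a(u)\Omega=0$, $a(u)\,v_1\circ\cdots\circ v_n=\frac1{\sqrt n}\sum_j\langle u,v_j\rangle v_1\circ\cdots\breve v_j\cdots\circ v_n$ ($\breve v_j$ omitted). For $r\in\mathbb N$, $P^{(r)}$ is the projection onto $\Gamma(\mathcal H^{(r)})$, $\mathcal H^{(r)}$ being spanned by $f\otimes e_k$ with $1\le k\le r-1$ ($\mathcal H^{(1)}=\{0\}$), and $P^{(0)}=0$. The extended free creation and annihilation operators are $$l^*(f)=\sum_{k=1}^\infty a^*(f\otimes e_k)\big(P^{(k)}-P^{(k-1)}\big),\qquad l(f)=\sum_{k=1}^\infty\big(P^{(k)}-P^{(k-1)}\big)a(f\otimes e_k),\qquad f\in\mathcal K,$$ on $\Gamma_0(\mathcal H)$ (strongly convergent series); they extend uniquely to bounded, mutually adjoint operators on $\Gamma(\mathcal H)$, denoted by the same symbols. $\mathcal C\subset B(\Gamma(\mathcal H))$ is the $C^*$-algebra generated by the identity and $\{l^*(f):f\in\mathcal K\}$, and $\pi$ is its defining representation on $\Gamma(\mathcal H)$. $\widehat{\mathcal D}$ is the set consisting of $\Omega$ and of all vectors $(d_{i_1}\otimes e_{k_1})\circ\cdots\circ(d_{i_n}\otimes e_{k_n})$, $n\ge1$, with $k_1\le\cdots\le k_n$, $i_r\le i_{r+1}$ whenever $k_r=k_{r+1}$, and $k_n\ne k_{n-1}+1$, where $k_0=0$ (so for $n=1$ the condition is $k_1\neq1$). $\mathcal D=\{x/\|x\|:x\in\widehat{\mathcal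 D}\}$, an orthonormal set. For $x\in\mathcal D$, $[\mathcal Cx]$ is the closed linear span of $\{Ax:A\in\mathcal C\}$ and $\pi_x$ is the cyclic representation $A\mapsto A|_{[\mathcal Cx]}$ of $\mathcal C$ on $[\mathcal Cx]$. $\mathcal F(\mathcal K)=\mathbb C\omega\oplus\bigoplus_{n\ge1}\mathcal K^{\otimes n}$ is the free (full) Fock space, with free creation operators $a^*(f)\omega=f$, $a^*(f)\,f_1\otimes\cdots\otimes f_n=f\otimes f_1\otimes\cdots\otimes f_n$ and annihilation operators $a(f)=(a^*(f))^*$; $\rho$ is the unital $*$-representation of $\mathcal C$ on $\mathcal F(\mathcal K)$ with $\rho(l^*(f))=a^*(f)$, $\rho(l(f))=a(f)$. *)

(* Defs.v *)
From HB Require Import structures.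
From mathcomp Require Import all_boot all_order all_algebra perm.
From mathcomp Require Import all_classical all_reals all_analysis.
From mathcomp Require Import complex.
Import Order.TTheory GRing.Theory Num.Theory.
Import numFieldNormedType.Exports.

Set Implicit Arguments.
Unset Strict Implicit.
Unset Printing Implicit Defensive.

Local Open Scope classical_set_scope.
Local Open Scope complex_scope.
Local Open Scope ring_scope.

(* Complex Hilbert spaces; the inner product is linear in its second argument
   and antilinear in the first. *)
HB.mixin Record isHilbert (R : realType) V of CompleteNormedModule R[i] V := {
  inner : V -> V -> R[i];
  inner_linear : forall (u : V) (c : R[i]) (v w : V),
    inner u (c *: v + w) = c * inner u v + inner u w;
  inner_conj : forall u v : V, inner v u = (inner u v)^*;
  inner_norm : forall u : V, inner u u = `|u| ^+ 2
}.

#[short(type="hilbertType")]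
HB.structure Definition Hilbert (R : realType) :=
  {V of isHilbert R V & CompleteNormedModule R[i] V}.

Notation "⟨ u , v ⟩" := (inner u v)
  (at level 0, u at level 99, v at level 99, format "⟨ u ,  v ⟩").

Definition lin_span (R : realType) (V : lmodType R[i]) (S : set V) : set V :=
  [set x | exists (n : nat) (c : 'I_n -> R[i]) (v : 'I_n -> V),
     (forall i, S (v i)) /\ x = \sum_(i < n) c i *: v i].

Definition closed_span (R : realType) (V : hilbertType R) (S : set V) : set V :=
  closure (lin_span S).

Definition closed_subspace (R : realType) (V : hilbertType R) (M : set V) :=
  [/\ M 0, forall (c : R[i]) u v, M u -> M v -> M (c *: u + v) & closed M].

Definition orthonormal_basis (R : realType) (V : hilbertType R)
    (I : eqType) (D : set I) (b : I -> V) : Prop :=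
  (forall i j, D i -> D j -> ⟨b i, b j⟩ = (i == j)%:R) /\
  closed_span (b @` D) = setT.

Definition linear_on (R : realType) (V W : lmodType R[i]) (M : set V)
    (A : V -> W) : Prop :=
  forall (c : R[i]) u v, M u -> M v -> A (c *: u + v) = c *: A u + A v.

Definition bounded_op (R : realType) (V W : hilbertType R) (A : V -> W) : Prop :=
  linear A /\ continuous A.

Definition adjoint (R : realType) (V W : hilbertType R)
    (A : V -> W) (B : W -> V) : Prop :=
  forall v w, ⟨A v, w⟩ = ⟨v, B w⟩.

Definition orth_proj (R : realType) (V : hilbertType R) (M : set V) (v : V) : V :=
  get [set p | M p /\ forall u, M u -> ⟨u, v - p⟩ = 0].

(* L^2(R^+), complex-valued, with Lebesgue measure. *)

Definition Rplus (R : realType) : set R := `[0, +oo[.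

Definition square_integrable (R : realType) (f : R -> R[i]) : Prop :=
  [/\ measurable_fun (@Rplus R) (fun t => complex.Re (f t)),
      measurable_fun (@Rplus R) (fun t => complex.Im (f t)) &
      (@lebesgue_measure R).-integrable (@Rplus R)
        (fun t => (complex.Re (f t) ^+ 2 + complex.Im (f t) ^+ 2)%:E)].

Definition integral_Rplus (R : realType) (f : R -> R[i]) : R[i] :=
  (\int[@lebesgue_measure R]_(t in @Rplus R) complex.Re (f t))%R +i*
  (\int[@lebesgue_measure R]_(t in @Rplus R) complex.Im (f t))%R.

(* The Hilbert space of classes of square-integrable functions.  The two axioms
   force cls f = cls g iff f = g a.e., and linearity of cls. *)
Record L2Rplus (R : realType) := {
  L2_space :> hilbertType R;
  cls : (R -> R[i]) -> L2_space;
  cls_surj : forall h, exists2 f, square_integrable f & cls f = h;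
  cls_inner : forall f g, square_integrable f -> square_integrable g ->
    ⟨cls f, cls g⟩ = integral_Rplus (fun t => (f t)^* * g t)
}.

(* Bilinearity of tens follows from tens_inner, the inner product being
   definite; the axioms determine the tensor product up to a unique unitary
   preserving elementary tensors. *)
Record hilbert_tensor (R : realType) (K G : hilbertType R) := {
  tensor_space :> hilbertType R;
  tens : K -> G -> tensor_space;
  tens_inner : forall f f' g g',
    ⟨tens f g, tens f' g'⟩ = ⟨f, f'⟩ * ⟨g, g'⟩;
  tens_total : closed_span [set tens p.1 p.2 | p in [set: K * G]] = setT
}.

(* The full Fock space: ffock_ten [:: f1; ...; fn] is the tensor product of
   the fi in the n-particle space and ffock_ten [::] is the vacuum.
   Multilinearity follows from ffock_inner as for hilbert_tensor. *)
Record full_fock (R : realType) (V : hilbertType R) := {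
  ffock_space :> hilbertType R;
  ffock_ten : seq V -> ffock_space;
  ffock_inner : forall us vs : seq V, ⟨ffock_ten us, ffock_ten vs⟩ =
    if size us == size vs then \prod_(i < size us) ⟨us`_i, vs`_i⟩ else 0;
  ffock_total : closed_span (range ffock_ten) = setT
}.

Definition symmetrization (R : realType) (V : hilbertType R) (F : full_fock V)
    (us : seq V) : F :=
  ((size us)`!%:R : R[i])^-1 *:
    \sum_(s : 'S_(size us)) ffock_ten F [seq us`_(s i) | i : 'I_(size us)].

(* The symmetric Fock space over V, as the closed subspace of the full Fock
   space F generated by the symmetrized products; sfock_incl is the inclusion
   and sfock_sym [:: u1; ...; un] the symmetric product of the ui, with
   sfock_sym [::] the vacuum. *)
Record sym_fock (R : realType) (V : hilbertType R) (F : full_fock V) := {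
  sfock_space :> hilbertType R;
  sfock_incl : sfock_space -> F;
  sfock_sym : seq V -> sfock_space;
  sfock_incl_linear : linear sfock_incl;
  sfock_incl_inner : forall x y, ⟨sfock_incl x, sfock_incl y⟩ = ⟨x, y⟩;
  sfock_incl_sym : forall us, sfock_incl (sfock_sym us) = symmetrization F us;
  sfock_total : closed_span (range sfock_sym) = setT
}.

(* Boson operators on the algebraic Fock space (the span of all symmetric
   products); their values elsewhere are never used. *)

Definition boson_creation (R : realType) (V : hilbertType R) (F : full_fock V)
    (Gam : sym_fock F) (u : V) : Gam -> Gam :=
  get [set A : Gam -> Gam | linear_on (lin_span (range (sfock_sym Gam))) A /\
    forall vs, A (sfock_sym Gam vs) =
      sqrtC (size vs).+1%:R *: sfock_sym Gam (u :: vs)].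
Arguments boson_creation {R V F} Gam u.

(* For vs = [::] the sum is empty, so the vacuum is sent to 0. *)
Definition boson_annihilation (R : realType) (V : hilbertType R)
    (F : full_fock V) (Gam : sym_fock F) (u : V) : Gam -> Gam :=
  get [set A : Gam -> Gam | linear_on (lin_span (range (sfock_sym Gam))) A /\
    forall vs, A (sfock_sym Gam vs) =
      (sqrtC (size vs)%:R)^-1 *: \sum_(j < size vs)
        ⟨u, vs`_j⟩ *: sfock_sym Gam (take j vs ++ drop j.+1 vs)].
Arguments boson_annihilation {R V F} Gam u.

(* In what follows e is indexed by {1, 2, ...}: e 0 is never used. *)

Definition Hr (R : realType) (K G : hilbertType R) (e : nat -> G)
    (H : hilbert_tensor K G) (r : nat) : set H :=
  closed_span [set x | exists f k, (1 <= k <= r - 1)%N /\ x = tens H f (e k)].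
Arguments Hr {R K G} e H r.

Definition Pr (R : realType) (K G : hilbertType R) (e : nat -> G)
    (H : hilbert_tensor K G) (F : full_fock H) (Gam : sym_fock F) (r : nat) :
    Gam -> Gam :=
  if r == 0%N then fun=> 0 else
  orth_proj (closed_span [set sfock_sym Gam us | us in
    [set us : seq H | forall u, u \in us -> Hr e H r u]]).
Arguments Pr {R K G} e {H F} Gam r.

Definition Gamma0 (R : realType) (K G : hilbertType R) (e : nat -> G)
    (H : hilbert_tensor K G) (F : full_fock H) (Gam : sym_fock F) : set Gam :=
  lin_span [set x | exists s : seq (K * nat),
    [/\ all (fun p => 1 <= p.2)%N s, sorted leq (unzip2 s) &
        x = sfock_sym Gam [seq tens H p.1 (e p.2) | p <- s]]].
Arguments Gamma0 {R K G} e {H F} Gam.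

Definition free_cr (R : realType) (K G : hilbertType R) (e : nat -> G)
    (H : hilbert_tensor K G) (F : full_fock H) (Gam : sym_fock F) (f : K) :
    Gam -> Gam :=
  get [set A : Gam -> Gam | bounded_op A /\
    forall x, Gamma0 e Gam x ->
      (\sum_(1 <= k < N.+1) boson_creation Gam (tens H f (e k))
         (Pr e Gam k x - Pr e Gam k.-1 x)) @[N --> \oo] --> A x].
Arguments free_cr {R K G} e {H F} Gam f.

Definition free_an (R : realType) (K G : hilbertType R) (e : nat -> G)
    (H : hilbert_tensor K G) (F : full_fock H) (Gam : sym_fock F) (f : K) :
    Gam -> Gam :=
  get [set A : Gam -> Gam | bounded_op A /\
    forall x, Gamma0 e Gam x ->
      (\sum_(1 <= k < N.+1)
         (Pr e Gam k (boson_annihilation Gam (tens H f (e k)) x) -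
          Pr e Gam k.-1 (boson_annihilation Gam (tens H f (e k)) x)))
        @[N --> \oo] --> A x].
Arguments free_an {R K G} e {H F} Gam f.

Definition Cstar_subalgebra (R : realType) (V : hilbertType R)
    (S : set (V -> V)) : Prop :=
  [/\ forall A, S A -> bounded_op A,
      forall (c : R[i]) A B, S A -> S B -> S (fun v => c *: A v + B v),
      forall A B, S A -> S B -> S (A \o B),
      forall A B, S A -> bounded_op B -> adjoint A B -> S B &
      forall A, bounded_op A ->
        (forall eps : R[i], 0 < eps ->
           exists2 B, S B & forall v, `|A v - B v| <= eps * `|v|) -> S A].

Definition algC (R : realType) (K G : hilbertType R) (e : nat -> G)
    (H : hilbert_tensor K G) (F : full_fock H) (Gam : sym_fock F) :
    set (Gam -> Gam) :=
  smallest (@Cstar_subalgebra R Gam)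
    ([set idfun] `|` range (free_cr e Gam)).
Arguments algC {R K G} e {H F} Gam.

Definition cyclic_space (R : realType) (V : hilbertType R) (C : set (V -> V))
    (x : V) : set V :=
  closed_span [set A x | A in C].

(* Unital *-representations, by operators on the closed subspace M of W. *)
Definition star_rep (R : realType) (V W : hilbertType R) (C : set (V -> V))
    (M : set W) (sigma : (V -> V) -> W -> W) : Prop :=
  [/\ closed_subspace M,
      forall A, C A -> [/\ forall w, M w -> M (sigma A w),
        linear_on M (sigma A) &
        exists c, forall w, M w -> `|sigma A w| <= c * `|w|],
      forall w, M w -> sigma idfun w = w,
      forall (c : R[i]) A B w, C A -> C B -> M w ->
        sigma (fun v => c *: A v + B v) w = c *: sigma A w + sigma B w /\
        sigma (A \o B) w = sigma A (sigma B w) &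
      forall A B w w', C A -> C B -> adjoint A B -> M w -> M w' ->
        ⟨sigma A w, w'⟩ = ⟨w, sigma B w'⟩].

Definition unitary_between (R : realType) (V W : hilbertType R)
    (M : set V) (N : set W) (U : V -> W) : Prop :=
  [/\ U @` M = N, linear_on M U &
      forall u v, M u -> M v -> ⟨U u, U v⟩ = ⟨u, v⟩].

Definition unitarily_isomorphic (R : realType) (V W : hilbertType R)
    (M : set V) (N : set W) : Prop :=
  exists U : V -> W, unitary_between M N U.

Definition unitarily_equivalent (R : realType) (V W W' : hilbertType R)
    (C : set (V -> V)) (M : set W) (sigma : (V -> V) -> W -> W)
    (N : set W') (tau : (V -> V) -> W' -> W') : Prop :=
  exists2 U : W -> W', unitary_between M N U &
    forall A w, C A -> M w -> U (sigma A w) = tau A (U w).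

Definition direct_sum (R : realType) (V : hilbertType R) (I : Type)
    (D : set I) (M : I -> set V) : Prop :=
  [/\ forall i, D i -> closed_subspace (M i),
      forall i j u v, D i -> D j -> i <> j -> M i u -> M j v -> ⟨u, v⟩ = 0 &
      closed_span (\bigcup_(i in D) M i) = setT].

(* sigma is the direct sum of the sigmas i on the summands M i: the component
   of sigma A w in M i is sigmas i A applied to that of w. *)
Definition rep_direct_sum (R : realType) (V W : hilbertType R)
    (C : set (V -> V)) (sigma : (V -> V) -> W -> W) (I : Type) (D : set I)
    (M : I -> set W) (sigmas : I -> (V -> V) -> W -> W) : Prop :=
  [/\ direct_sum D M,
      forall i, D i -> star_rep C (M i) (sigmas i) &
      forall A w i, C A -> D i ->
        orth_proj (M i) (sigma A w) = sigmas i A (orth_proj (M i) w)].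

Definition pi_def (V : Type) : (V -> V) -> V -> V := id.

Definition pi_cyc (R : realType) (V : hilbertType R) (C : set (V -> V))
    (x : V) : (V -> V) -> V -> V :=
  fun A => A \_ (cyclic_space C x).

(* s lists the index pairs (i_r, k_r); nth 0 (0 :: unzip2 s) r is k_r, with
   k_0 = 0. *)
Definition admissible (s : seq (nat * nat)) : Prop :=
  let i r := nth 0%N (0%N :: unzip1 s) r in
  let k r := nth 0%N (0%N :: unzip2 s) r in
  let n := size s in
  [/\ forall r, (1 <= r <= n)%N -> (1 <= i r)%N /\ (1 <= k r)%N,
      forall r, (1 <= r < n)%N -> (k r <= k r.+1)%N,
      forall r, (1 <= r < n)%N -> k r = k r.+1 -> (i r <= i r.+1)%N &
      (1 <= n)%N -> k n <> (k n.-1).+1].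

Definition Dhat (R : realType) (K G : hilbertType R) (d : nat -> K)
    (e : nat -> G) (H : hilbert_tensor K G) (F : full_fock H)
    (Gam : sym_fock F) : set Gam :=
  [set sfock_sym Gam [seq tens H (d p.1) (e p.2) | p <- s] | s in admissible].
Arguments Dhat {R K G} d e {H F} Gam.

Definition Dset (R : realType) (K G : hilbertType R) (d : nat -> K)
    (e : nat -> G) (H : hilbert_tensor K G) (F : full_fock H)
    (Gam : sym_fock F) : set Gam :=
  [set `|x|^-1 *: x | x in Dhat d e Gam].
Arguments Dset {R K G} d e {H F} Gam.

Definition ffock_cr (R : realType) (V : hilbertType R) (F : full_fock V)
    (f : V) : F -> F :=
  get [set A : F -> F | bounded_op A /\
    forall fs, A (ffock_ten F fs) = ffock_ten F (f :: fs)].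
Arguments ffock_cr {R V} F f.

Definition ffock_an (R : realType) (V : hilbertType R) (F : full_fock V)
    (f : V) : F -> F :=
  get [set A : F -> F | bounded_op A /\ adjoint (ffock_cr F f) A].
Arguments ffock_an {R V} F f.

Definition free_fock_rep (R : realType) (K G : hilbertType R) (e : nat -> G)
    (H : hilbert_tensor K G) (F : full_fock H) (Gam : sym_fock F)
    (FK : full_fock K) (rho : (Gam -> Gam) -> FK -> FK) : Prop :=
  [/\ star_rep (algC e Gam) [set: FK] rho,
      forall f : K, rho (free_cr e Gam f) = ffock_cr FK f &
      forall f : K, rho (free_an e Gam f) = ffock_an FK f].

(* Main.v *)
Require Import Defs.
From HB Require Import structures.
From mathcomp Require Import all_boot all_order all_algebra perm.
From mathcomp Require Import all_classical all_reals all_analysis.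
From mathcomp Require Import complex zify.
Import Order.TTheory GRing.Theory Num.Theory.
Import numFieldNormedType.Exports.

Set Implicit Arguments.
Unset Strict Implicit.
Unset Printing Implicit Defensive.

Local Open Scope classical_set_scope.
Local Open Scope complex_scope.
Local Open Scope ring_scope.

(** The operators [l^*(f)] satisfy [<l^*(f) u, l^*(g) v> = <f, g> <u, v>]: like
the free creation operators, they are isometric for unit vectors [f] and have
orthogonal ranges for orthogonal ones.  Such a family has a Wold decomposition.  Call a
unit vector [x] wandering if it is orthogonal to the range of every [l^*(f)].
The map [f1 ⊗ ... ⊗ fn |-> l^*(f1) ... l^*(fn) x] preserves inner products, so it
extends to an isometry [Phi] of the full Fock space onto a subspace that is
reducing for the C*-algebra [C] and that is [[C x]]; orthogonal wandering vectors
generate orthogonal subspaces.  The theorem then says that [D] is an orthonormal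
set of wandering vectors that generates the whole space
([wold_decomposition]).

Two points of the abstract part need care.  That [Phi] intertwines [rho] with the
identity representation is clear on the generators, and it passes to their norm
closure only if [rho] is norm continuous, which is not among the axioms of a
representation.  It is automatic ([rep_norm_le]): if [A] has small norm, then
[1 - A^* A] is the square of a self-adjoint element [B] of [C], obtained as a
fixed point of a contraction ([Cstar_sqrt]), and
[|w|^2 - |rho(A) w|^2 = |rho(B) w|^2 >= 0].  Secondly, adjoints, orthogonal
projections and isometries are only known explicitly on total sets.  One
extension principle for bounded linear relations ([graph_extension]) provides
all of them.

For the concrete part, rescale the symmetric products to
[nsym us = sqrt(n!) u1 ∘ ... ∘ un], so that inner products become permanents and
a creation operator just adds a letter.  On a product of vectors [f_j ⊗ e_(k_j)]
the projection [P^(k)] is the identity or zero, according as all labels [k_j] are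
below [k] or not; hence in the series that defines [l^*(f)] only the term with
[k] one above the largest label survives ([free_crP]): [l^*(f)] adds the letter
[f ⊗ e_(max k_j + 1)].  Expanding the permanent along a letter with such a label
leaves at most one term, because this label occurs only once in the other word;
this is the relation for [<l^*(f) u, l^*(g) v>] ([word_vec_create]).

The products of the basis vectors [d_i ⊗ e_k] are orthogonal, and each of them is
determined by its multiset of letters.  Such a product is in the range of the
creation operators if its largest label occurs once and exceeds the second
largest by one (by convention a missing label is 0), and otherwise it is
orthogonal to all these ranges ([irreducible_orth]).  The words of the second
kind, sorted, are exactly those that define [D] ([admissibleP]).  Stripping the
top letter as long as it is of the first kind shows that every basis product is
[l^*(d_i1) ... l^*(d_ip)] applied to a vector of [D], up to a scalar
([Dset_words_total]). *)

(** * Inner products *)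

Section InnerProduct.
Variables (R : realType) (V : hilbertType R).
Implicit Types (u v w : V) (c : R[i]).

Lemma innerDr u v w : ⟨u, v + w⟩ = ⟨u, v⟩ + ⟨u, w⟩.
Proof. by rewrite -[v]scale1r inner_linear mul1r scale1r. Qed.

Lemma inner0r u : ⟨u, 0 : V⟩ = 0.
Proof. by apply/(addrI ⟨u, 0 : V⟩); rewrite -innerDr !addr0. Qed.

Lemma innerZr c u v : ⟨u, c *: v⟩ = c * ⟨u, v⟩.
Proof. by rewrite -[c *: v]addr0 inner_linear inner0r addr0. Qed.

Lemma innerNr u v : ⟨u, - v⟩ = - ⟨u, v⟩.
Proof. by rewrite -scaleN1r innerZr mulN1r. Qed.

Lemma innerBr u v w : ⟨u, v - w⟩ = ⟨u, v⟩ - ⟨u, w⟩.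
Proof. by rewrite innerDr innerNr. Qed.

Lemma innerDl u v w : ⟨v + w, u⟩ = ⟨v, u⟩ + ⟨w, u⟩.
Proof. by rewrite (inner_conj u) innerDr rmorphD /= -!(inner_conj u). Qed.

Lemma innerZl c u v : ⟨c *: v, u⟩ = c^* * ⟨v, u⟩.
Proof. by rewrite (inner_conj u) innerZr rmorphM /= -(inner_conj u). Qed.

Lemma inner0l u : ⟨0 : V, u⟩ = 0.
Proof. by rewrite (inner_conj u) inner0r rmorph0. Qed.

Lemma innerNl u v : ⟨- v, u⟩ = - ⟨v, u⟩.
Proof. by rewrite (inner_conj u) innerNr rmorphN /= -(inner_conj u). Qed.

Lemma innerBl u v w : ⟨v - w, u⟩ = ⟨v, u⟩ - ⟨w, u⟩.
Proof. by rewrite innerDl innerNl. Qed.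

Lemma inner_sumr u (I : Type) (r : seq I) (P : pred I) (F : I -> V) :
  ⟨u, \sum_(i <- r | P i) F i⟩ = \sum_(i <- r | P i) ⟨u, F i⟩.
Proof.
exact: (big_morph (fun w => ⟨u, w⟩) (innerDr u) (inner0r u)).
Qed.

Lemma inner_suml u (I : Type) (r : seq I) (P : pred I) (F : I -> V) :
  ⟨\sum_(i <- r | P i) F i, u⟩ = \sum_(i <- r | P i) ⟨F i, u⟩.
Proof.
exact: (big_morph (fun w => ⟨w, u⟩) (innerDl u) (inner0l u)).
Qed.

Lemma inner_eq0 u : ⟨u, u⟩ = 0 -> u = 0.
Proof. by move/eqP; rewrite inner_norm expf_eq0 /= normr_eq0 => /eqP. Qed.

Lemma inner_ext u v : (forall w, ⟨w, u⟩ = ⟨w, v⟩) -> u = v.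
Proof.
move=> uv; apply/eqP; rewrite -subr_eq0; apply/eqP/inner_eq0.
by rewrite innerBr uv subrr.
Qed.

Lemma inner_sym0 u v : ⟨u, v⟩ = 0 -> ⟨v, u⟩ = 0.
Proof. by rewrite (inner_conj u v) => ->; rewrite rmorph0. Qed.

Lemma norm_inner_le u v : `|⟨u, v⟩| <= `|u| * `|v|.
Proof.
have [->|v0] := eqVneq v 0; first by rewrite inner0r normr0 normr0 mulr0.
have nv : 0 < `|v| by rewrite normr_gt0.
have nv2 : 0 < ⟨v, v⟩ by rewrite inner_norm exprn_gt0.
(* the component of u orthogonal to v *)
pose w := u - (⟨v, u⟩ / ⟨v, v⟩) *: v.
have ww : ⟨w, w⟩ = ⟨u, u⟩ - `|⟨u, v⟩| ^+ 2 / ⟨v, v⟩.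
  have vw : ⟨v, w⟩ = 0.
    by rewrite innerBr innerZr divfK ?subrr// gt_eqF.
  rewrite {1}/w innerBl innerZl vw mulr0 subr0 innerBr innerZr; congr (_ - _).
  by rewrite mulrAC (inner_conj u v) normCK [X in _ = X / _]mulrC.
have : 0 <= ⟨w, w⟩ by rewrite inner_norm exprn_ge0.
rewrite ww subr_ge0 ler_pdivrMr// !inner_norm -exprMn.
by rewrite ler_pXn2r// nnegrE ?mulr_ge0.
Qed.

End InnerProduct.

(** * Approximation and completeness *)

Section Approximation.
Variable (R : realType).

Lemma half_pow_small (eps : R[i]) : 0 < eps -> exists n, 2^-1 ^+ n < eps.
Proof.
rewrite ltcE /= => /andP[/eqP e0 ep].
have [n hn] : exists n, (2^-1 : R) ^+ n < complex.Re eps.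
  have /cvgrPdist_lt/(_ _ ep)[N _ /(_ N (leqnn N))] :=
    @cvg_expr R (2^-1) (ltac:(by rewrite ger0_norm// invf_lt1// ltr1n)).
  rewrite sub0r normrN ger0_norm ?exprn_ge0// => hN.
  by exists N.
exists n.
have -> : (2^-1 : R[i]) ^+ n = ((2^-1 ^+ n : R)%:C)%C.
  by rewrite rmorphXn /= fmorphV rmorph_nat.
by rewrite ltcE /= -e0 eqxx.
Qed.

(** The order of the complex numbers being partial, the usual argument by
    contradiction is available for nonnegative quantities only. *)
Lemma ler_all_eps (x b c : R[i]) : 0 <= x -> 0 <= b -> 0 <= c ->
  (forall eps, 0 < eps -> x <= b + c * eps) -> x <= b.
Proof.
move=> x0 b0 c0 h; rewrite real_leNgt ?ger0_real//; apply/negP => bx.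
have xb : 0 < x - b by rewrite subr_gt0.
have c1 : 0 < c + 1 by rewrite ltr_wpDl.
have := h ((x - b) / (c + 1)) ltac:(by rewrite divr_gt0).
rewrite addrC -lerBlDr mulrA ler_pdivlMr// mulrC ler_pM2r//.
by rewrite gerDl ler10.
Qed.

Variable V : hilbertType R.

Lemma closure_approxP (S : set V) v :
  closure S v <-> forall eps : R[i], 0 < eps -> exists2 s, S s & `|v - s| < eps.
Proof.
split.
  move=> cl eps ep; have [s [Ss sb]] := cl _ (nbhsx_ballx v _ ep).
  by exists s => //; rewrite -ball_normE /= in sb.
move=> h B /nbhs_ballP[eps /= ep bB].
have [s Ss sv] := h eps ep.
by exists s; split => //; apply: bB; rewrite -ball_normE.
Qed.

(** Completeness is only ever used along sequences with a geometric rate. *)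
Lemma complete_seq (u : nat -> V) (c : R[i]) : 0 <= c ->
  (forall n m, (n <= m)%N -> `|u n - u m| <= c * 2^-1 ^+ n) ->
  exists l, forall n, `|u n - l| <= c * 2^-1 ^+ n.
Proof.
move=> c0 hu.
have small eps : 0 < eps -> exists N, c * 2^-1 ^+ N < eps.
  move=> ep; have [N hN] := @half_pow_small (eps / (c + 1))
    (ltac:(by rewrite divr_gt0// ltr_wpDl)).
  exists N; move: hN; rewrite ltr_pdivlMr ?ltr_wpDl// => /(le_lt_trans _); apply.
  by rewrite mulrC ler_wpM2l ?exprn_ge0// lerDl.
have /cvg_ex[/= l ul] : cvg (u @ \oo).
  apply: cauchy_cvg; apply: cauchy_exP => eps ep.
  have [N hN] := small eps ep.
  exists (u N); exists N => //= m /= Nm.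
  by rewrite -ball_normE /=; apply: le_lt_trans hN; exact: hu.
exists l => n.
apply: (@ler_all_eps _ _ 1) => //; first by rewrite mulr_ge0// exprn_ge0.
move=> eps ep; rewrite mul1r.
have /cvgrPdist_lt/(_ _ ep)[N _ hN] := ul.
have := hN (maxn N n) (leq_maxl _ _).
have := hu n (maxn N n) (leq_maxr _ _).
set x := u (maxn _ _) => nx xl.
rewrite -(subrK x (u n)) -addrA (le_trans (ler_normD _ _))//.
by rewrite lerD// distrC ltW.
Qed.

End Approximation.

(** * Closed subspaces and total sets *)

Section Subspaces.
Variables (R : realType) (V : hilbertType R).
Implicit Types (S M : set V) (u v w : V).

Lemma closed_subspaceI M : M 0 ->
  (forall (c : R[i]) u v, M u -> M v -> M (c *: u + v)) ->
  (forall v, (forall eps : R[i], 0 < eps -> exists2 u, M u & `|v - u| < eps) ->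
     M v) ->
  closed_subspace M.
Proof. by move=> M0 Ml Mc; split=> // v /closure_approxP; exact: Mc. Qed.

Lemma closed_subspace_lim M v : closed_subspace M ->
  (forall eps : R[i], 0 < eps -> exists2 u, M u & `|v - u| < eps) -> M v.
Proof. by case=> _ _ cM h; apply: cM; apply/closure_approxP. Qed.

Lemma closed_subspaceZ M (c : R[i]) u : closed_subspace M -> M u -> M (c *: u).
Proof. by case=> M0 Ml _ Mu; rewrite -[_ *: _]addr0; exact: Ml. Qed.

Lemma closed_subspaceB M u v : closed_subspace M -> M u -> M v -> M (u - v).
Proof.
by case=> M0 Ml _ Mu Mv; rewrite addrC -scaleN1r; exact: Ml.
Qed.

Lemma closed_subspace_sum M (n : nat) (c : 'I_n -> R[i]) (v : 'I_n -> V) :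
  closed_subspace M -> (forall i, M (v i)) -> M (\sum_(i < n) c i *: v i).
Proof.
by case=> M0 Ml _ Mv; apply: big_rec => // i x _; apply: Ml.
Qed.

Lemma closed_span_sub S M : closed_subspace M -> S `<=` M -> closed_span S `<=` M.
Proof.
move=> cM SM v /closure_approxP h; apply: closed_subspace_lim => // eps ep.
have [u [n [c [w [Sw ->]]]] vu] := h eps ep.
by exists (\sum_(i < n) c i *: w i) => //; apply: closed_subspace_sum => // i; exact: SM.
Qed.

Lemma sub_closed_span S : S `<=` closed_span S.
Proof.
move=> u Su; apply: subset_closure.
exists 1%N, (fun=> 1), (fun=> u); split=> //.
by rewrite big_ord1 scale1r.
Qed.

Lemma lin_span_comb S (c : R[i]) u v :
  lin_span S u -> lin_span S v -> lin_span S (c *: u + v).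
Proof.
move=> [n [a [x [Sx ->]]]] [m [b [y [Sy ->]]]].
exists (n + m)%N, (fun i => match fintype.split i with inl j => c * a j | inr j => b j end),
  (fun i => match fintype.split i with inl j => x j | inr j => y j end); split.
  by move=> i; case: fintype.split.
rewrite big_split_ord /= scaler_sumr; congr (_ + _); apply: eq_bigr => i _.
  by rewrite (unsplitK (inl i)) scalerA.
by rewrite (unsplitK (inr i)).
Qed.

Lemma lin_span0 S : lin_span S 0.
Proof.
exists 0%N, (fun=> 0), (fun=> 0); split; first by case.
by rewrite big_ord0.
Qed.

Lemma closed_span_subspace S : closed_subspace (closed_span S).
Proof.
apply: closed_subspaceI.
- exact/subset_closure/lin_span0.
- move=> c u v /closure_approxP hu /closure_approxP hv; apply/closure_approxP => eps ep.
  have c1 : 0 < `|c| + 1 by rewrite ltr_wpDl.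
  have [x Sx ux] := hu (eps / 2 / (`|c| + 1)) ltac:(by rewrite !divr_gt0).
  have [y Sy vy] := hv (eps / 2) ltac:(by rewrite divr_gt0).
  exists (c *: x + y); first exact: lin_span_comb.
  rewrite opprD addrACA -scalerBr (le_lt_trans (ler_normD _ _))//.
  rewrite [eps]splitr ler_ltD// normrZ.
  move: ux; rewrite ltr_pdivlMr// => /ltW /(le_trans _); apply.
  by rewrite mulrC ler_wpM2l// lerDl.
- move=> v h; apply/closure_approxP => eps ep.
  have [x /closure_approxP hx vx] := h (eps / 2) ltac:(by rewrite divr_gt0).
  have [y Sy xy] := hx (eps / 2) ltac:(by rewrite divr_gt0).
  exists y => //; rewrite -(subrK x v) -addrA (le_lt_trans (ler_normD _ _))//.
  by rewrite [eps]splitr ltrD.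
Qed.

(** The working form of density: a property that defines a closed subspace holds
    everywhere as soon as it holds on a total set. *)
Lemma total_ind S M : closed_span S = setT -> closed_subspace M -> S `<=` M ->
  forall v, M v.
Proof. by move=> tS cM SM v; apply: (closed_span_sub cM SM); rewrite tS. Qed.

Lemma total_sub S M : closed_span S = setT -> S `<=` closed_span M ->
  closed_span M = setT.
Proof.
move=> tS SM; apply/seteqP; split=> // v _.
exact: (total_ind tS (closed_span_subspace M)).
Qed.

Lemma orth_projE M v p : closed_subspace M -> M p ->
  (forall u, M u -> ⟨u, v - p⟩ = 0) -> orth_proj M v = p.
Proof.
move=> cM Mp hp; rewrite /orth_proj; set P := [set _ | _].
have [Mq hq] : P (get P) by apply: getPex; exists p.
apply/eqP; rewrite -subr_eq0; apply/eqP/inner_eq0.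
set q := get P in Mq hq *.
(* two projections of v differ by a vector of M that is orthogonal to M *)
have e : q - p = (v - p) - (v - q).
  by rewrite opprB [v - p]addrC addrACA subrr addr0 addrC.
have Mqp : M (q - p) by exact: closed_subspaceB.
rewrite {2}e.
by rewrite innerBr hp// hq// subrr.
Qed.

End Subspaces.

(** * Bounded operators *)

(** Boundedness with a witness, so that estimates can be chained. *)
Definition bounded_by (R : realType) (V W : hilbertType R) (c : R[i])
    (A : V -> W) : Prop :=
  [/\ 0 <= c, linear A & forall v, `|A v| <= c * `|v|].

Section BoundedOperators.
Variables (R : realType).
Implicit Types (V W : hilbertType R).

Lemma linear_fun0 V W (A : V -> W) : linear A -> A 0 = 0.
Proof.
by move=> lA; have := lA (-1) 0 0; rewrite scaler0 addr0 scaleN1r addNr.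
Qed.

Lemma linear_funB V W (A : V -> W) u v : linear A -> A (u - v) = A u - A v.
Proof. by move=> lA; rewrite addrC -scaleN1r lA scaleN1r addrC. Qed.

Lemma linear_fun_sum V W (A : V -> W) n (c : 'I_n -> R[i]) (v : 'I_n -> V) :
  linear A -> A (\sum_(i < n) c i *: v i) = \sum_(i < n) c i *: A (v i).
Proof.
move=> lA; apply: (big_rec2 (fun x y => A x = y)); first exact: linear_fun0.
by move=> i y x _ <-; rewrite lA.
Qed.

Lemma bounded_by_op V W c (A : V -> W) : bounded_by c A -> bounded_op A.
Proof.
move=> [c0 lA bA]; split=> // v; apply/cvgrPdist_lt => eps ep.
have c1 : 0 < c + 1 by rewrite ltr_wpDl.
near=> w; rewrite -linear_funB//; apply: (le_lt_trans (bA _)).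
have : `|v - w| < eps / (c + 1).
  near: w; apply/nbhs_ballP; exists (eps / (c + 1)) => /=; first by rewrite divr_gt0.
  by move=> y; rewrite -ball_normE.
rewrite ltr_pdivlMr//; apply: le_lt_trans.
by rewrite mulrC ler_wpM2l// lerDl.
Unshelve. all: by end_near. Qed.

Lemma bounded_op_by V W (A : V -> W) : bounded_op A -> exists c, bounded_by c A.
Proof.
move=> [lA cA].
pose L : {linear V -> W} := HB.pack A (GRing.isLinear.Build _ _ _ _ A lA).
have /linear_boundedP : bounded_near L (nbhs (0 : V)).
  by apply/linear_bounded_continuous.
move=> [M [Mr hM]].
have Mp : 0 < `|M| + 1 by rewrite ltr_wpDl.
exists (`|M| + 1); split; [exact: ltW | exact: lA |].
apply: hM; apply: le_lt_trans (real_ler_norm Mr) _.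
by rewrite ltrDl.
Qed.

Lemma bounded_by_comb V W c c' (a : R[i]) (A B : V -> W) :
  bounded_by c A -> bounded_by c' B ->
  bounded_by (`|a| * c + c') (fun v => a *: A v + B v).
Proof.
move=> [c0 lA bA] [c0' lB bB]; split.
- by rewrite addr_ge0// mulr_ge0.
- by move=> k u v; rewrite lA lB !scalerDr !scalerA addrACA mulrC.
- move=> v; rewrite (le_trans (ler_normD _ _))// normrZ mulrDl lerD//.
  by rewrite -mulrA ler_wpM2l.
Qed.

Lemma bounded_by_comp V W (X : hilbertType R) c c' (A : W -> X) (B : V -> W) :
  bounded_by c A -> bounded_by c' B -> bounded_by (c * c') (A \o B).
Proof.
move=> [c0 lA bA] [c0' lB bB]; split.
- by rewrite mulr_ge0.
- by move=> k u v /=; rewrite lB lA.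
- by move=> v /=; rewrite (le_trans (bA _))// -mulrA ler_wpM2l.
Qed.

Lemma bounded_by_id V : bounded_by 1 (@idfun V).
Proof. by split=> // v; rewrite mul1r. Qed.

Lemma closed_subspace_preimage V W c (A : V -> W) (N : set W) :
  bounded_by c A -> closed_subspace N -> closed_subspace (A @^-1` N).
Proof.
move=> [c0 lA bA] cN; have [N0 Nl _] := cN; apply: closed_subspaceI.
- by rewrite /= linear_fun0.
- by move=> k u v /= Nu Nv; rewrite lA; exact: Nl.
- move=> v h /=; apply: closed_subspace_lim => // eps ep.
  have c1 : 0 < c + 1 by rewrite ltr_wpDl.
  have [u Nu uv] := h (eps / (c + 1)) ltac:(by rewrite divr_gt0).
  exists (A u) => //; rewrite -linear_funB// (le_lt_trans (bA _))//.
  move: uv; rewrite ltr_pdivlMr//; apply: le_lt_trans.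
  by rewrite mulrC ler_wpM2l// lerDl.
Qed.

Lemma closed_subspace0 V : closed_subspace [set 0 : V].
Proof.
apply: closed_subspaceI => //.
- by move=> c u v -> ->; rewrite scaler0 addr0.
- move=> v h; apply/eqP; rewrite -normr_eq0; apply/eqP.
  apply/eqP; rewrite eq_le normr_ge0 andbT; apply: (@ler_all_eps _ _ _ 1) => //.
  by move=> eps ep; have [u -> /ltW] := h _ ep; rewrite subr0 add0r mul1r.
Qed.

Lemma closed_subspace_orth V (u : V) : closed_subspace [set v | ⟨u, v⟩ = 0].
Proof.
apply: closed_subspaceI => /=.
- exact: inner0r.
- by move=> c v w hv hw; rewrite inner_linear hv hw mulr0 addr0.
- move=> v h; apply/eqP; rewrite -normr_eq0 eq_le normr_ge0 andbT.
  apply: (@ler_all_eps _ _ _ `|u|) => // eps ep.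
  have [w hw vw] := h _ ep.
  rewrite add0r -[⟨u, v⟩]subr0 -hw -innerBr (le_trans (norm_inner_le _ _))//.
  by rewrite ler_wpM2l// ltW.
Qed.

Lemma eq_on_total V W c c' (A B : V -> W) (S : set V) :
  bounded_by c A -> bounded_by c' B -> closed_span S = setT ->
  (forall v, S v -> A v = B v) -> forall v, A v = B v.
Proof.
move=> bA bB tS AB v; apply/eqP; rewrite -subr_eq0 addrC -scaleN1r; apply/eqP.
have bD := bounded_by_comb (-1) bB bA.
apply: (total_ind tS (closed_subspace_preimage bD (closed_subspace0 W))).
by move=> w Sw /=; rewrite AB// scaleN1r addNr.
Qed.

Lemma eq_inner_total V (S : set V) u v : closed_span S = setT ->
  (forall w, S w -> ⟨w, u⟩ = ⟨w, v⟩) -> u = v.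
Proof.
move=> tS uv; apply: inner_ext => w; apply/eqP; rewrite -subr_eq0 -innerBr.
apply/eqP/inner_sym0.
apply: (total_ind tS (closed_subspace_orth (u - v))) => x Sx /=.
by apply: inner_sym0; rewrite innerBr uv// subrr.
Qed.

Lemma closed_subspace_inner_rel V W c (B : V -> W) (k : R[i]) x u :
  bounded_by c B -> closed_subspace [set v | ⟨x, B v⟩ = k * ⟨u, v⟩].
Proof.
move=> [c0 lB bB]; apply: closed_subspaceI => /=.
- by rewrite linear_fun0// !inner0r mulr0.
- by move=> a v w hv hw; rewrite lB !inner_linear hv hw mulrDr mulrCA.
- move=> v h; apply/eqP; rewrite -subr_eq0 -normr_eq0 eq_le normr_ge0 andbT.
  apply: (@ler_all_eps _ _ _ (`|x| * c + `|k| * `|u|)) => //.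
    by rewrite addr_ge0// mulr_ge0.
  move=> eps ep; have [w hw /ltW vw] := h _ ep.
  have -> : ⟨x, B v⟩ - k * ⟨u, v⟩ = ⟨x, B (v - w)⟩ - k * ⟨u, v - w⟩.
    rewrite linear_funB// !innerBr hw mulrBr opprB addrA; congr (_ - _).
    by rewrite addrNK.
  rewrite add0r (le_trans (ler_normB _ _))// mulrDl lerD//.
    rewrite (le_trans (norm_inner_le _ _))// -mulrA ler_wpM2l//.
    by rewrite (le_trans (bB _))// ler_wpM2l.
  by rewrite normrM -mulrA ler_wpM2l// (le_trans (norm_inner_le _ _))// ler_wpM2l.
Qed.

(** Extend first in the second argument, then in the first one after
    conjugation. *)
Lemma inner_rel_total V W c c' (A B : V -> W) (k : R[i]) (S : set V) :
  bounded_by c A -> bounded_by c' B -> closed_span S = setT ->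
  (forall u v, S u -> S v -> ⟨A u, B v⟩ = k * ⟨u, v⟩) ->
  forall u v, ⟨A u, B v⟩ = k * ⟨u, v⟩.
Proof.
move=> bA bB tS AB u v.
have AB' w : S w -> ⟨B v, A w⟩ = k^* * ⟨v, w⟩.
  move=> Sw; rewrite inner_conj (inner_conj w) -rmorphM /=; congr (_^*).
  apply: (total_ind tS (closed_subspace_inner_rel k (A w) w bB)) => z Sz /=.
  exact: AB.
rewrite inner_conj (inner_conj v) -[k]conjCK -rmorphM /=; congr (_^*).
exact: (total_ind tS (closed_subspace_inner_rel k^* (B v) v bA)).
Qed.

End BoundedOperators.

(** * Operators prescribed on a total set *)

Section Extension.
Variable R : realType.
Implicit Types (V W : hilbertType R).

Lemma normr_lin_le V (a : R[i]) (u v : V) (e1 e2 : R[i]) :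
  `|u| <= e1 -> `|v| <= e2 -> `|a *: u + v| <= `|a| * e1 + e2.
Proof.
move=> ue ve; rewrite (le_trans (ler_normD _ _))// normrZ lerD//.
exact: ler_wpM2l.
Qed.

(** A bounded linear relation with dense domain is the graph of an operator
    after taking its closure.  Isometric extensions, adjoints and orthogonal
    projections are all obtained from it, because each of them is determined by
    a linear relation for which a witness is only known on a total set. *)
Lemma graph_extension V W (G : V -> W -> Prop) (c : R[i]) : 0 <= c ->
  G 0 0 ->
  (forall (a : R[i]) v w v' w', G v w -> G v' w' -> G (a *: v + v') (a *: w + w')) ->
  (forall v w, G v w -> `|w| <= c * `|v|) ->
  closed_span [set v | exists w, G v w] = setT ->
  exists A : V -> W, [/\ bounded_by c A, forall v w, G v w -> A v = w &
    forall v (eps : R[i]), 0 < eps ->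
      exists v' w', [/\ G v' w', `|v - v'| < eps & `|A v - w'| < eps]].
Proof.
move=> c0 G0 Gl Gb Gd.
have dense v (eps : R[i]) : 0 < eps -> exists v' w', G v' w' /\ `|v - v'| < eps.
  have : closed_span [set v | exists w, G v w] v by rewrite Gd.
  move=> /closure_approxP + ep => /(_ _ ep)[_ [n [a [x [Gx ->]]]] vx].
  suff [w Gw] : exists w, G (\sum_(i < n) a i *: x i) w.
    by exists (\sum_(i < n) a i *: x i), w.
  apply: (big_ind (fun u => exists w, G u w)); first by exists 0.
  - move=> u u' [w Gw] [w' Gw']; exists (1 *: w + w').
    by rewrite -[u]scale1r; exact: Gl.
  - move=> i _; have [w Gw] := Gx i; exists (a i *: w + 0).
    by rewrite -[_ *: x i]addr0; exact: Gl.
have c1 : 0 < c + 1 by rewrite ltr_wpDl.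
have GB v w v' w' : G v w -> G v' w' -> `|w - w'| <= c * `|v - v'|.
  move=> h h'; apply: Gb; rewrite [v - _]addrC [w - _]addrC -(scaleN1r v') -(scaleN1r w').
  exact: Gl.
(* the closure of the relation *)
pose Gc v w := forall eps : R[i], 0 < eps ->
  exists v' w', [/\ G v' w', `|v - v'| < eps & `|w - w'| < eps].
have Gc_tot v : exists w, Gc v w.
  have : forall n, exists p : V * W, G p.1 p.2 /\ `|v - p.1| < 2^-1 ^+ n.
    move=> n; have [v' [w' ?]] := dense v (2^-1 ^+ n) ltac:(by rewrite exprn_gt0).
    by exists (v', w').
  move=> /choice[p hp].
  have vp n m : (n <= m)%N -> `|(p n).1 - (p m).1| <= 2 * 2^-1 ^+ n.
    move=> nm; rewrite -(subrK v (p n).1) -addrA (le_trans (ler_normD _ _))//.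
    rewrite mulr_natl mulr2n lerD ?(distrC _ v) ?ltW//; first by case: (hp n).
    case: (hp m) => _ /lt_le_trans; apply.
    by rewrite ler_wiXn2l// ?invr_ge0// invf_le1// ler1n.
  have [|n m nm|l hl] := @complete_seq R W (fun n => (p n).2) (c * 2).
  - by rewrite mulr_ge0.
  - rewrite (le_trans (GB _ _ _ _ (hp n).1 (hp m).1))// -mulrA ler_wpM2l//.
    exact: vp.
  exists l => eps ep.
  have D1 : 1 <= c * 2 + 1 by rewrite lerDr mulr_ge0.
  have D0 : 0 < c * 2 + 1 by exact: lt_le_trans ltr01 D1.
  have [n hn] := @half_pow_small R (eps / (c * 2 + 1))
    ltac:(by rewrite divr_gt0).
  exists (p n).1, (p n).2; have [Gp vpn] := hp n; split=> //.
    apply: (lt_trans vpn); apply: (lt_le_trans hn).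
    by rewrite ler_pdivrMr// ler_pMr.
  rewrite distrC (le_lt_trans (hl n))//.
  move: hn; rewrite ltr_pdivlMr//; apply: le_lt_trans.
  by rewrite mulrC ler_wpM2l ?exprn_ge0// lerDl.
have Gc_bound v w : Gc v w -> `|w| <= c * `|v|.
  move=> h; apply: (@ler_all_eps _ _ _ (c + 1)) => //; try by rewrite ?mulr_ge0 ?addr_ge0.
  move=> eps ep; have [v' [w' [Gv' /ltW vv' /ltW ww']]] := h _ ep.
  rewrite -(subrK w' w) (le_trans (ler_normD _ _))// mulrDl mul1r addrA addrC.
  rewrite lerD// (le_trans (Gb _ _ Gv'))// -mulrDr ler_wpM2l//.
  by rewrite -[v'](subrK v) addrC (le_trans (ler_normD _ _))// lerD// distrC.
have Gc_lin (a : R[i]) v w v' w' : Gc v w -> Gc v' w' -> Gc (a *: v + v') (a *: w + w').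
  move=> h h' eps ep.
  have a1 : 0 < `|a| + 1 by rewrite ltr_wpDl.
  have sum_lt (X : hilbertType R) (u u' : X) : `|u| < eps / (`|a| + 1) ->
      `|u'| < eps / (`|a| + 1) -> `|a *: u + u'| < eps.
    move=> /ltW ue u'e; rewrite (le_lt_trans (normr_lin_le a ue (lexx _)))//.
    rewrite (lt_le_trans (ler_ltD (lexx _) u'e))//.
    by rewrite -[X in _ + X]mul1r -mulrDl mulrC divfK// gt_eqF.
  have [x [y [Gxy vx wy]]] := h (eps / (`|a| + 1)) ltac:(by rewrite divr_gt0).
  have [x' [y' [Gxy' vx' wy']]] := h' (eps / (`|a| + 1)) ltac:(by rewrite divr_gt0).
  exists (a *: x + x'), (a *: y + y'); split; first exact: Gl.
    by rewrite opprD addrACA -scalerBr; exact: sum_lt.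
  by rewrite opprD addrACA -scalerBr; exact: sum_lt.
have G_Gc v w : G v w -> Gc v w.
  by move=> Gvw eps ep; exists v, w; rewrite !subrr normr0 normr0.
have Gc_fun v w w' : Gc v w -> Gc v w' -> w = w'.
  move=> h h'; apply/eqP; rewrite -subr_eq0 -normr_le0 addrC -scaleN1r.
  by rewrite (le_trans (Gc_bound _ _ (Gc_lin (-1) _ _ _ _ h' h)))// scaleN1r addNr normr0 mulr0.
have [A hA] := choice Gc_tot.
exists A; split=> //.
- split=> // [a u v|v]; last exact: Gc_bound.
  by apply: (Gc_fun (a *: u + v)) => //; exact: Gc_lin.
- by move=> v w Gvw; apply: (Gc_fun v) => //; exact: G_Gc.
Qed.

(** The Gram matrix of a family determines the norms of its linear combinations,
    hence the relation that sends a combination of the [s i] to the same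
    combination of the [t i] is bounded. *)
Lemma isometric_extension V W (I : Type) (s : I -> V) (t : I -> W) (c : R[i]) :
  0 <= c -> closed_span (range s) = setT ->
  (forall i j, ⟨t i, t j⟩ = c ^+ 2 * ⟨s i, s j⟩) ->
  exists2 A : V -> W, bounded_by c A & forall i, A (s i) = t i.
Proof.
move=> c0 ts hst.
pose comb (X : hilbertType R) (f : I -> X) (r : seq (R[i] * I)) :=
  \sum_(p <- r) p.1 *: f p.2.
pose G v w := exists r, v = comb V s r /\ w = comb W t r.
have Gs i : G (s i) (t i).
  by exists [:: (1, i)]; rewrite /comb !big_seq1 !scale1r.
have norm_comb r : ⟨comb W t r, comb W t r⟩ = c ^+ 2 * ⟨comb V s r, comb V s r⟩.
  rewrite !inner_suml mulr_sumr; apply: eq_bigr => p _.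
  rewrite !inner_sumr mulr_sumr; apply: eq_bigr => q _.
  by rewrite !innerZl !innerZr hst (mulrCA q.1) [LHS]mulrCA.
have [|||//|A [bA GA _]] := @graph_extension V W G c c0.
- by exists [::]; rewrite /comb !big_nil.
- move=> a v w v' w' [r [-> ->]] [r' [-> ->]].
  exists ([seq (a * p.1, p.2) | p <- r] ++ r').
  rewrite /comb !big_cat !big_map /= !scaler_sumr.
  by split; congr (_ + _); apply: eq_bigr => p _; rewrite scalerA.
- move=> v w [r [-> ->]].
  rewrite -(@ler_pXn2r _ 2) ?nnegrE ?mulr_ge0// exprMn -!inner_norm.
  by rewrite norm_comb.
- by apply: (total_sub ts) => _ [i _ <-]; apply: sub_closed_span; exists (t i).
by exists A => // i; exact: GA.
Qed.

Lemma adjoint_linear V W (A : V -> W) (B : W -> V) : adjoint A B -> linear B.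
Proof.
by move=> AB a u v; apply: inner_ext => w; rewrite inner_linear -!AB inner_linear.
Qed.

Lemma adjoint_norm_le V W (A : V -> W) (B : W -> V) c : 0 <= c ->
  (forall v, `|A v| <= c * `|v|) -> adjoint A B -> forall w, `|B w| <= c * `|w|.
Proof.
move=> c0 bA AB v; have [->|n0] := eqVneq (B v) 0; first by rewrite normr0 mulr_ge0.
have n1 : 0 < `|B v| by rewrite normr_gt0.
rewrite -(ler_pM2l n1) -expr2 -inner_norm -AB.
rewrite -[X in X <= _]ger0_norm; last by rewrite AB inner_norm exprn_ge0.
by rewrite (le_trans (norm_inner_le _ _))// mulrCA mulrA ler_wpM2r.
Qed.

Lemma adjoint_bounded V W (A : V -> W) (B : W -> V) c :
  bounded_by c A -> adjoint A B -> bounded_by c B.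
Proof.
move=> [c0 lA bA] AB; split=> //; first exact: adjoint_linear AB.
exact: adjoint_norm_le AB.
Qed.

Lemma adjoint_sym V W (A : V -> W) (B : W -> V) : adjoint A B -> adjoint B A.
Proof. by move=> AB v w; rewrite inner_conj -AB -inner_conj. Qed.

Lemma adjoint_unique V W (A : V -> W) (B B' : W -> V) :
  adjoint A B -> adjoint A B' -> B = B'.
Proof.
by move=> AB AB'; apply/funext => w; apply: inner_ext => v; rewrite -AB -AB'.
Qed.

(** The vectors [w] for which the functional [v |-> <A v, w>] is represented by
    some [z] form a closed subspace. *)
Lemma adjoint_exists V W (A : V -> W) c (S : set W) : bounded_by c A ->
  closed_span S = setT ->
  (forall w, S w -> exists z, forall v, ⟨A v, w⟩ = ⟨v, z⟩) ->
  exists B, adjoint A B.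
Proof.
move=> bA tS hS; have [c0 lA hA] := bA.
pose G w z := forall v, ⟨A v, w⟩ = ⟨v, z⟩.
have [||||B [bB GB cB]] := @graph_extension W V G c c0.
- by move=> v; rewrite !inner0r.
- by move=> a w z w' z' h h' v; rewrite !inner_linear h h'.
- move=> w z h; have [->|n0] := eqVneq z 0; first by rewrite normr0 mulr_ge0.
  have n1 : 0 < `|z| by rewrite normr_gt0.
  rewrite -(ler_pM2l n1) -expr2 -inner_norm -h.
  rewrite -[X in X <= _]ger0_norm; last by rewrite h inner_norm exprn_ge0.
  by rewrite (le_trans (norm_inner_le _ _))// mulrCA mulrA ler_wpM2r.
- by apply: (total_sub tS) => w Sw; apply: sub_closed_span; exact: hS.
exists B => v w.
have tot := total_ind tS (closed_subspace_inner_rel 1 v (A v) bB).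
have /= := tot _ w; rewrite mul1r => -> // z Sz /=.
by rewrite mul1r; have [y hy] := hS z Sz; rewrite (GB _ _ hy) hy.
Qed.

(** The vectors that have an orthogonal projection onto a closed subspace form a
    closed subspace themselves. *)
Lemma orth_proj_exists V (M S : set V) : closed_subspace M ->
  closed_span S = setT ->
  (forall v, S v -> exists2 p, M p & forall u, M u -> ⟨u, v - p⟩ = 0) ->
  forall v, exists2 p, M p & forall u, M u -> ⟨u, v - p⟩ = 0.
Proof.
move=> cM tS hS; have [M0 Ml _] := cM.
pose G v p := M p /\ forall u, M u -> ⟨u, v - p⟩ = 0.
have [||||B [bB GB cB]] := @graph_extension V V G 1 ler01.
- by split=> // u _; rewrite subrr inner0r.
- move=> a v p v' p' [Mp h] [Mp' h']; split; first exact: Ml.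
  by move=> u Mu; rewrite opprD addrACA -scalerBr inner_linear h// h'// mulr0 addr0.
- move=> v p [Mp h]; rewrite mul1r -(@ler_pXn2r _ 2) ?nnegrE// -!inner_norm.
  have pv : ⟨p, v⟩ = ⟨p, p⟩ by apply/eqP; rewrite -subr_eq0 -innerBr h.
  have : 0 <= ⟨v - p, v - p⟩ by rewrite inner_norm exprn_ge0.
  rewrite innerBl (h _ Mp) subr0 innerBr (inner_conj p) pv -inner_conj.
  by rewrite subr_ge0.
- apply: (total_sub tS) => v Sv; apply: sub_closed_span.
  by have [p Mp hp] := hS v Sv; exists p.
move=> v; exists (B v).
  apply: closed_subspace_lim => // eps ep.
  by have [v' [p [[Mp _] _ Bp]]] := cB v eps ep; exists p.
move=> u Mu; rewrite innerBr; apply/eqP; rewrite subr_eq0; apply/eqP.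
have tot := total_ind tS (closed_subspace_inner_rel 1 u u bB).
have /= := tot _ v; rewrite mul1r => -> // w Sw /=.
have [p Mp hp] := hS w Sw; rewrite (GB w p)// mul1r.
by apply/eqP; rewrite eq_sym -subr_eq0 -innerBr hp.
Qed.

(** Values prescribed on a family extend linearly to its algebraic span as soon
    as they have a formal adjoint against a total family: a vanishing
    combination is then mapped to a vector orthogonal to everything. *)
Lemma linear_on_span_exists V W (I : Type) (s : I -> V) (t : I -> W) (S : set W) :
  closed_span S = setT ->
  (forall y, S y -> exists z, forall i, ⟨y, t i⟩ = ⟨z, s i⟩) ->
  exists A : V -> W, linear_on (lin_span (range s)) A /\ forall i, A (s i) = t i.
Proof.
move=> tS h.
pose G v w := exists n (a : 'I_n -> R[i]) (f : 'I_n -> I),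
  v = \sum_(i < n) a i *: s (f i) /\ w = \sum_(i < n) a i *: t (f i).
have G_in v w y z : (forall i, ⟨y, t i⟩ = ⟨z, s i⟩) -> G v w -> ⟨y, w⟩ = ⟨z, v⟩.
  move=> yz [n [a [f [-> ->]]]]; rewrite !inner_sumr; apply: eq_bigr => i _.
  by rewrite !innerZr yz.
have G_fun v w w' : G v w -> G v w' -> w = w'.
  move=> g g'; apply: (eq_inner_total tS) => y Sy; have [z yz] := h y Sy.
  by rewrite !(G_in v _ y z).
have G_ex v : exists w, lin_span (range s) v -> G v w.
  have [[n [a [x [hx ->]]]]|nv] := pselect (lin_span (range s) v); last by exists 0.
  have /choice[f hf] : forall i, exists j, s j = x i.
    by move=> i; have [j _ <-] := hx i; exists j.
  exists (\sum_(i < n) a i *: t (f i)) => _; exists n, a, f; split=> //.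
  by apply: eq_bigr => i _; rewrite hf.
have [A hA] := choice G_ex; exists A; split.
  move=> c u v Su Sv; apply: (G_fun (c *: u + v)).
    by apply: hA; exact: lin_span_comb.
  have [n [a [f [-> ->]]]] := hA u Su; have [m [a' [f' [-> ->]]]] := hA v Sv.
  exists (n + m)%N, (fun i => match fintype.split i with inl j => c * a j | inr j => a' j end),
    (fun i => match fintype.split i with inl j => f j | inr j => f' j end).
  by rewrite !big_split_ord /= !scaler_sumr; split; congr (_ + _);
    apply: eq_bigr => i _; rewrite ?(unsplitK (inl i)) ?(unsplitK (inr i)) ?scalerA.
move=> i; apply: (G_fun (s i)).
  apply: hA; exists 1%N, (fun=> 1), (fun=> s i); split; first by move=> _; exists i.
  by rewrite big_ord1 scale1r.
by exists 1%N, (fun=> 1), (fun=> i); rewrite !big_ord1 !scale1r.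
Qed.

Lemma linear_on_sum V W (S : set V) (A : V -> W) n (c : 'I_n -> R[i])
    (x : 'I_n -> V) : linear_on (lin_span S) A -> (forall i, lin_span S (x i)) ->
  A (\sum_(i < n) c i *: x i) = \sum_(i < n) c i *: A (x i).
Proof.
move=> lA; elim: n c x => [|n IH] c x Sx.
  rewrite !big_ord0; have := lA (-1) 0 0 (lin_span0 S) (lin_span0 S).
  by rewrite scaler0 addr0 scaleN1r addNr.
rewrite !big_ord_recl lA ?IH//.
apply: (big_rec (lin_span S)); first exact: lin_span0.
by move=> i y _ Sy; exact: lin_span_comb.
Qed.

Lemma isometry_norm (W X : hilbertType R) (Phi : W -> X) :
  (forall u v, ⟨Phi u, Phi v⟩ = ⟨u, v⟩) -> forall u, `|Phi u| = `|u|.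
Proof.
move=> iP u; apply/eqP; rewrite -(@eqrXn2 _ 2)// -!inner_norm.
by rewrite iP.
Qed.

(** A convergent sequence in the range has a Cauchy sequence of preimages. *)
Lemma isometry_range_closed (W X : hilbertType R) (Phi : W -> X) :
  linear Phi -> (forall u v, ⟨Phi u, Phi v⟩ = ⟨u, v⟩) ->
  closed_subspace (range Phi).
Proof.
move=> lP iP; apply: closed_subspaceI.
- by exists 0 => //; exact: linear_fun0.
- by move=> c _ _ [u _ <-] [v _ <-]; exists (c *: u + v) => //; exact: lP.
- move=> v h.
  have : forall n, exists u, `|v - Phi u| < 2^-1 ^+ n.
    move=> n; have [_ [u _ <-] hu] := h (2^-1 ^+ n) ltac:(by rewrite exprn_gt0).
    by exists u.
  move=> /choice[u hu].
  have pow_le n m : (n <= m)%N -> (2^-1 : R[i]) ^+ m <= 2^-1 ^+ n.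
    by move=> nm; rewrite ler_wiXn2l// ?invr_ge0// invf_le1// ler1n.
  have [n m nm|l hl] := @complete_seq R W u 2 ltac:(by []).
    rewrite -(isometry_norm iP) (linear_funB _ _ lP) -(subrK v (Phi (u n))) -addrA.
    rewrite (le_trans (ler_normD _ _))// mulr_natl mulr2n lerD//.
      by rewrite distrC ltW.
    by rewrite (le_trans (ltW (hu m)))// pow_le.
  exists l => //; apply/eqP; rewrite eq_sym -subr_eq0 -normr_eq0 eq_le normr_ge0 andbT.
  apply: (@ler_all_eps _ _ _ (1 + 2)) => // eps ep.
  have [n /ltW hn] := half_pow_small ep.
  rewrite add0r -(subrK (Phi (u n)) v) -addrA (le_trans (ler_normD _ _))//.
  rewrite mulrDl mul1r lerD//; first by rewrite (le_trans (ltW (hu n))).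
  by rewrite -(linear_funB _ _ lP) (isometry_norm iP) (le_trans (hl n))// ler_wpM2l.
Qed.

End Extension.

(** * C*-algebras of operators and their representations *)

Section CstarAlgebras.
Variable R : realType.
Implicit Types (V W : hilbertType R).

Lemma adjoint_comb V (A A' B B' : V -> V) (a : R[i]) :
  adjoint A A' -> adjoint B B' ->
  adjoint (fun v => a *: A v + B v) (fun v => a^* *: A' v + B' v).
Proof.
by move=> hA hB v w; rewrite innerDl innerZl innerDr innerZr hA hB.
Qed.

Lemma adjoint_comp V (A A' B B' : V -> V) :
  adjoint A A' -> adjoint B B' -> adjoint (A \o B) (B' \o A').
Proof. by move=> hA hB v w /=; rewrite hA hB. Qed.

Lemma adjoint_dist V (A A' B B' : V -> V) (eps : R[i]) : 0 <= eps ->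
  adjoint A A' -> adjoint B B' ->
  (forall v, `|A v - B v| <= eps * `|v|) ->
  forall v, `|A' v - B' v| <= eps * `|v|.
Proof.
move=> ep hA hB h.
apply: (@adjoint_norm_le _ _ _ (fun v => A v - B v) (fun v => A' v - B' v)) => //.
by move=> v w; rewrite innerBl innerBr hA hB.
Qed.

(** Taking adjoints preserves operator norms, so the adjoints of a norm
    convergent sequence form a Cauchy sequence. *)
Lemma adjoint_norm_limit V (A : V -> V) :
  (forall eps : R[i], 0 < eps -> exists B B' : V -> V, adjoint B B' /\
     forall v, `|A v - B v| <= eps * `|v|) ->
  exists A', adjoint A A'.
Proof.
move=> h.
have : forall n, exists p : (V -> V) * (V -> V), adjoint p.1 p.2 /\
    forall v, `|A v - p.1 v| <= 2^-1 ^+ n * `|v|.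
  move=> n; have [B [B' hB]] := h (2^-1 ^+ n) ltac:(by rewrite exprn_gt0).
  by exists (B, B').
move=> /choice[p hp].
have pow_le n m : (n <= m)%N -> (2^-1 : R[i]) ^+ m <= 2^-1 ^+ n.
  by move=> nm; rewrite ler_wiXn2l// ?invr_ge0// invf_le1// ler1n.
have cau w : exists l, forall n, `|(p n).2 w - l| <= (2 * `|w|) * 2^-1 ^+ n.
  apply: complete_seq => [|n m nm]; first by rewrite mulr_ge0.
  rewrite mulrAC.
  have e0 : 0 <= 2 * (2^-1 : R[i]) ^+ n by rewrite mulr_ge0// exprn_ge0.
  move: w; apply: (adjoint_dist e0 (hp n).1 (hp m).1) => v.
  rewrite -(subrK (A v) ((p n).1 v)) -addrA (le_trans (ler_normD _ _))//.
  rewrite mulr_natl mulr2n mulrDl lerD//; first by rewrite distrC; exact: (hp n).2.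
  by rewrite (le_trans ((hp m).2 v))// ler_wpM2r// pow_le.
have [A' hA'] := choice cau; exists A' => v w.
apply/eqP; rewrite -subr_eq0 -normr_eq0 eq_le normr_ge0 andbT.
apply: (@ler_all_eps _ _ _ (`|v| * `|w| + `|v| * (2 * `|w|))) => // eps ep.
have [n /ltW hn] := half_pow_small ep.
have -> : ⟨A v, w⟩ - ⟨v, A' w⟩ = ⟨A v - (p n).1 v, w⟩ + ⟨v, (p n).2 w - A' w⟩.
  by rewrite innerBl innerBr (hp n).1 addrA subrK.
rewrite add0r (le_trans (ler_normD _ _))// mulrDl lerD//.
  rewrite (le_trans (norm_inner_le _ _))// [X in _ <= X]mulrAC ler_wpM2r//.
  by rewrite (le_trans ((hp n).2 v))// mulrC ler_wpM2l.
rewrite (le_trans (norm_inner_le _ _))// -[X in _ <= X]mulrA ler_wpM2l//.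
by rewrite (le_trans (hA' _ _))// ler_wpM2l// mulr_ge0.
Qed.

Lemma smallest_Cstar V (Gs : set (V -> V)) :
  (forall A, Gs A -> bounded_op A) ->
  Cstar_subalgebra (smallest (@Cstar_subalgebra R V) Gs).
Proof.
move=> bG.
have all_Cstar : Cstar_subalgebra [set A : V -> V | bounded_op A].
  split=> //=.
  - move=> c A B /bounded_op_by[a bA] /bounded_op_by[b bB].
    exact: bounded_by_op (bounded_by_comb c bA bB).
  - move=> A B /bounded_op_by[a bA] /bounded_op_by[b bB].
    exact: bounded_by_op (bounded_by_comp bA bB).
split.
- by move=> A; apply; split=> // B; exact: bG.
- move=> c A B hA hB S [cS GS]; have [_ cl _ _ _] := cS.
  by apply: cl; [exact: hA | exact: hB].
- move=> A B hA hB S [cS GS]; have [_ _ cl _ _] := cS.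
  by apply: cl; [exact: hA | exact: hB].
- move=> A B hA bB AB S [cS GS]; have [_ _ _ cl _] := cS.
  by apply: cl AB => //; exact: hA.
- move=> A bA h S [cS GS]; have [_ _ _ _ cl] := cS.
  apply: cl => // eps ep; have [B hB AB] := h eps ep.
  by exists B => //; exact: hB.
Qed.

(** The induction carries the adjoint along, because the adjoint of a norm limit is
    obtained as the limit of the adjoints of the approximants. *)
Lemma Cstar_ind V (Gs : set (V -> V)) (P : (V -> V) -> (V -> V) -> Prop) :
  (forall A A', P A A' -> bounded_op A /\ adjoint A A') ->
  (forall A A', P A A' -> P A' A) ->
  (forall (a : R[i]) A A' B B', P A A' -> P B B' ->
     P (fun v => a *: A v + B v) (fun v => a^* *: A' v + B' v)) ->
  (forall A A' B B', P A A' -> P B B' -> P (A \o B) (B' \o A')) ->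
  (forall A A', bounded_op A -> bounded_op A' -> adjoint A A' ->
     (forall eps : R[i], 0 < eps -> exists B B', [/\ P B B',
        forall v, `|A v - B v| <= eps * `|v| &
        forall v, `|A' v - B' v| <= eps * `|v|]) -> P A A') ->
  (forall A, Gs A -> exists A', P A A') ->
  forall A, smallest (@Cstar_subalgebra R V) Gs A -> exists A', P A A'.
Proof.
move=> Padj Psym Pcomb Pcomp Plim PG A hA.
apply: (hA [set A | exists A', P A A']); split=> //; split=> /=.
- by move=> B [B' /Padj[]].
- move=> c B D [B' hB] [D' hD]; exists (fun v => c^* *: B' v + D' v); exact: Pcomb.
- by move=> B D [B' hB] [D' hD]; exists (D' \o B'); exact: Pcomp.
- move=> B D [B' hB] bD BD; exists B.
  have [_ BB'] := Padj _ _ hB; rewrite (adjoint_unique BD BB').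
  exact: Psym.
- move=> B bB h.
  have [|B' BB'] := @adjoint_norm_limit V B.
    move=> eps ep; have [D [D' hD] BD] := h eps ep.
    by exists D, D'; split=> //; have [] := Padj _ _ hD.
  exists B'; apply: Plim => //.
    by have [b hb] := bounded_op_by bB; exact: bounded_by_op (adjoint_bounded hb BB').
  move=> eps ep; have [D [D' hD] BD] := h eps ep.
  exists D, D'; split=> //; apply: (adjoint_dist (ltW ep) BB') BD.
  by have [] := Padj _ _ hD.
Qed.

Section Subalgebra.
Variables (V : hilbertType R) (C : set (V -> V)).
Hypothesis (cC : Cstar_subalgebra C).

Lemma Cstar_scale (a : R[i]) A : C A -> C (fun v => a *: A v).
Proof.
case: cC => _ cl _ _ _ CA.
have -> : (fun v => a *: A v) = (fun v => (a - 1) *: A v + A v).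
  by apply/funext => v; rewrite scalerBl scale1r subrK.
exact: cl.
Qed.

Lemma Cstar_add A B : C A -> C B -> C (fun v => A v + B v).
Proof.
case: cC => _ cl _ _ _ CA CB.
have -> : (fun v => A v + B v) = (fun v => 1 *: A v + B v).
  by apply/funext => v; rewrite scale1r.
exact: cl.
Qed.

(** For [B = 1 - Y] the equation [B^2 = 1 - T] reads [Y = (T + Y^2) / 2], and the
    right-hand side contracts the ball of radius 1/2. *)
Lemma Cstar_sqrt (T : V -> V) : C T -> adjoint T T ->
  (forall v, `|T v| <= 2^-1 * `|v|) -> C idfun ->
  exists B, [/\ C B, adjoint B B & forall v, B (B v) = v - T v].
Proof.
move=> CT TT nT Cid; have [Cb Cl Cc Ca Clim] := cC.
(* the iterates of Y |-> (T + Y^2) / 2, written so that they stay in C *)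
pose Y := fix Y n : V -> V := if n is m.+1 then
  (fun v => 2^-1 *: (T v + Y m (Y m v))) else (fun v => 0 *: T v).
have CY n : C (Y n).
  elim: n => [|n IH]; first exact: Cstar_scale.
  by apply: Cstar_scale; apply: Cstar_add => //; exact: (Cc _ _ IH IH).
have half_conj : (2^-1 : R[i])^* = 2^-1 by rewrite fmorphV rmorph_nat.
have YY n : adjoint (Y n) (Y n).
  elim: n => [|n IH] v w /=; first by rewrite !scale0r inner0l inner0r.
  by rewrite innerZl innerZr half_conj innerDl innerDr TT !IH.
have nY n v : `|Y n v| <= 2^-1 * `|v|.
  elim: n v => [|n IH] v /=; first by rewrite scale0r normr0 mulr_ge0// invr_ge0.
  rewrite normrZ ger0_norm ?invr_ge0// ler_wpM2l ?invr_ge0//.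
  rewrite (le_trans (ler_normD _ _))// [X in _ <= X](splitr `|v|) lerD//.
    by rewrite mulrC.
  rewrite (le_trans (IH _))// [X in _ <= X]mulrC ler_wpM2l ?invr_ge0//.
  by rewrite (le_trans (IH v))// ler_piMl// invf_le1// ler1n.
have lY n : linear (Y n) by case: (Cb _ (CY n)).
have step n v : `|Y n.+1 v - Y n v| <= 2^-1 ^+ n.+1 * `|v|.
  elim: n v => [|n IH] v.
    rewrite /= !scale0r addr0 subr0 expr1 normrZ ger0_norm ?invr_ge0//.
    rewrite ler_wpM2l ?invr_ge0// (le_trans (nT v))// ler_piMl//.
    by rewrite invf_le1// ler1n.
  have -> : Y n.+2 v - Y n.+1 v = 2^-1 *: (Y n.+1 (Y n.+1 v - Y n v) +
      (Y n.+1 (Y n v) - Y n (Y n v))).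
    by rewrite (linear_funB _ _ (lY n.+1)) addrA subrK [LHS]/= -scalerBr opprD addrACA subrr add0r.
  rewrite normrZ ger0_norm ?invr_ge0// exprS -mulrA ler_wpM2l ?invr_ge0//.
  rewrite (le_trans (ler_normD _ _))// [X in _ <= X]splitr lerD//.
    by rewrite (le_trans (nY _ _))// mulrC ler_wpM2r ?invr_ge0.
  rewrite (le_trans (IH _))// -mulrA ler_wpM2l ?exprn_ge0// mulrC.
  exact: nY.
have cau n m v : (n <= m)%N -> `|Y n v - Y m v| <= `|v| * 2^-1 ^+ n.
  move=> nm; have [k ->] : exists k, m = (n + k)%N by exists (m - n)%N; rewrite subnKC.
  suff : `|Y n v - Y (n + k)%N v| <= `|v| * (2^-1 ^+ n - 2^-1 ^+ (n + k)).
    move/le_trans; apply; rewrite ler_wpM2l// lerBlDr lerDl exprn_ge0//.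
  elim: k => [|k IH]; first by rewrite addn0 !subrr normr0 mulr0.
  rewrite -(subrK (Y (n + k)%N v) (Y n v)) -addrA (le_trans (ler_normD _ _))//.
  have -> : (2^-1 : R[i]) ^+ n - 2^-1 ^+ (n + k.+1) =
      (2^-1 ^+ n - 2^-1 ^+ (n + k)) + 2^-1 ^+ (n + k).+1.
    rewrite addnS -addrA; congr (_ + _).
    by rewrite exprSr {2}[(2^-1 : R[i]) ^+ (n + k)]splitr opprD subrK.
  rewrite mulrDr lerD// distrC addnS mulrC; exact: step.
have lim v : exists l, forall n, `|Y n v - l| <= `|v| * 2^-1 ^+ n.
  by apply: complete_seq => // n m; exact: cau.
have [Z hZ] := choice lim.
have ZZ : adjoint Z Z.
  have [|Z' ZZ'] := @adjoint_norm_limit V Z.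
    move=> eps ep; have [n /ltW hn] := half_pow_small ep.
    exists (Y n), (Y n); split=> // v; rewrite distrC (le_trans (hZ v n))//.
    by rewrite mulrC ler_wpM2r.
  suff e : Z = Z' by rewrite [X in adjoint _ X]e.
  apply/funext => v; apply/eqP; rewrite -subr_eq0 -normr_eq0 eq_le normr_ge0 andbT.
  apply: (@ler_all_eps _ _ _ (2 * `|v|)) => // eps ep; have [n /ltW hn] := half_pow_small ep.
  rewrite -(subrK (Y n v) (Z v)) -addrA (le_trans (ler_normD _ _))// add0r.
  rewrite mulr_natl mulr2n mulrDl lerD//.
    by rewrite distrC (le_trans (hZ v n))// ler_wpM2l.
  rewrite mulrC; apply: (adjoint_dist (ltW ep) (YY n) ZZ') => w.
  by rewrite (le_trans (hZ w n))// mulrC ler_wpM2r.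
have bZ : bounded_by 2^-1 Z.
  have lZ : linear Z by exact: adjoint_linear ZZ.
  split=> // v.
  apply: (@ler_all_eps _ _ _ `|v|) => // eps ep; have [n /ltW hn] := half_pow_small ep.
  rewrite -(subrK (Y n v) (Z v)) (le_trans (ler_normD _ _))// addrC lerD//.
  by rewrite distrC (le_trans (hZ v n))// ler_wpM2l.
have CZ : C Z.
  apply: Clim; first exact: bounded_by_op bZ.
  move=> eps ep; have [n /ltW hn] := half_pow_small ep.
  exists (Y n) => // v; rewrite distrC (le_trans (hZ v n))//.
  by rewrite mulrC ler_wpM2r.
have eqZ v : 2 *: Z v = T v + Z (Z v).
  apply/eqP; rewrite -subr_eq0 -normr_eq0 eq_le normr_ge0 andbT.
  apply: (@ler_all_eps _ _ _ (2 * `|v| + (`|v| + `|v|))) => // eps ep.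
  have [n /ltW hn] := half_pow_small ep.
  have half1 : (2^-1 : R[i]) <= 1 by rewrite invf_le1// ler1n.
  have -> : 2 *: Z v - (T v + Z (Z v)) = 2 *: (Z v - Y n.+1 v) +
      (Y n (Y n v - Z v) + (Y n (Z v) - Z (Z v))).
    rewrite (linear_funB _ _ (lY n)) scalerBr /= scalerA divff ?pnatr_eq0//.
    by rewrite scale1r !opprD !addrA !subrK.
  rewrite add0r (le_trans (ler_normD _ _))// mulrDl lerD//.
    rewrite normrZ ger0_norm// -mulrA ler_wpM2l// distrC (le_trans (hZ v n.+1))//.
    by rewrite ler_wpM2l// exprS (le_trans _ hn)// ler_piMl ?exprn_ge0.
  rewrite (le_trans (ler_normD _ _))// mulrDl lerD//.
    rewrite (le_trans (nY _ _))// (le_trans (ler_piMl _ half1))//.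
    by rewrite (le_trans (hZ v n))// ler_wpM2l.
  rewrite (le_trans (hZ _ n))// ler_pM ?exprn_ge0//.
  by case: bZ => _ _ bZ; rewrite (le_trans (bZ v))// ler_piMl.
exists (fun v => (-1) *: Z v + v); split.
- exact: (Cl (-1) Z idfun).
- move=> v w; rewrite innerDl innerDr innerZl innerZr ZZ.
  by rewrite rmorphN rmorph1.
- move=> v; have [_ lZ _] := bZ; rewrite lZ !scaleN1r opprD opprK.
  have -> : T v = 2 *: Z v - Z (Z v) by rewrite eqZ addrK.
  by rewrite scaler_nat mulr2n opprB opprD [RHS]addrC !addrA.
Qed.

End Subalgebra.

Lemma star_rep_scale V W (C : set (V -> V)) (M : set W)
    (rho : (V -> V) -> W -> W) A (a : R[i]) w : star_rep C M rho -> C A -> M w ->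
  rho (fun v => a *: A v) w = a *: rho A w.
Proof.
move=> [_ _ _ rc _] CA Mw.
have -> : (fun v => a *: A v) = (fun v => (a - 1) *: A v + A v).
  by apply/funext => v; rewrite scalerBl scale1r subrK.
by have [-> _] := rc (a - 1) A A w CA CA Mw; rewrite scalerBl scale1r subrK.
Qed.

(** Representations of C*-algebras are automatically continuous: if A is small
    then 1 - A* A is a square B^2, and |w|^2 - |rho(A) w|^2 = |rho(B) w|^2. *)
Lemma rep_norm_le V W (C : set (V -> V)) (rho : (V -> V) -> W -> W) A A'
    (eps : R[i]) : Cstar_subalgebra C -> C idfun -> star_rep C setT rho ->
  C A -> C A' -> adjoint A A' -> 0 < eps ->
  (forall v, `|A v| <= eps * `|v|) -> forall w, `|rho A w| <= 2 * eps * `|w|.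
Proof.
move=> cC Cid srho CA CA' AA' ep nA w.
have [_ _ rid rc radj] := srho.
have e2 : 0 < 2 * eps by rewrite mulr_gt0.
pose k := (2 * eps)^-1; have k0 : 0 < k by rewrite invr_gt0.
pose A1 v := k *: A v; pose A1' v := k *: A' v.
have CA1 : C A1 by exact: Cstar_scale.
have CA1' : C A1' by exact: Cstar_scale.
have AA1 : adjoint A1 A1'.
  by move=> v u; rewrite innerZl innerZr AA' conj_Creal// ger0_real// ltW.
have nA1 v : `|A1 v| <= 2^-1 * `|v|.
  rewrite normrZ gtr0_norm// /k mulrC ler_pdivrMr//.
  by rewrite mulrACA mulVf ?pnatr_eq0// mul1r mulrC.
have nA1' v : `|A1' v| <= 2^-1 * `|v|.
  by apply: adjoint_norm_le nA1 AA1 v; rewrite invr_ge0.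
pose T := A1' \o A1.
have CT : C T by case: cC => _ _ cl _ _; exact: cl.
have TT : adjoint T T by exact: adjoint_comp (adjoint_sym AA1) AA1.
have nT v : `|T v| <= 2^-1 * `|v|.
  rewrite (le_trans (nA1' _))// ler_wpM2l ?invr_ge0// (le_trans (nA1 v))//.
  by rewrite ler_piMl// invf_le1// ler1n.
have [B [CB BB eB]] := Cstar_sqrt cC CT TT nT Cid.
have eBB : B \o B = (fun v => (-1) *: T v + idfun v).
  by apply/funext => v /=; rewrite eB scaleN1r addrC.
have nB : ⟨rho B w, rho B w⟩ = ⟨w, w⟩ - ⟨rho A1 w, rho A1 w⟩.
  rewrite (radj B B)//; have [_ <-] := rc 0 B B w CB CB I.
  rewrite eBB; have [-> _] := rc (-1) T idfun w CT Cid I.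
  have [_ ->] := rc 0 A1' A1 w CA1' CA1 I.
  by rewrite rid// innerDr innerZr mulN1r addrC (radj A1 A1').
have : 0 <= ⟨rho B w, rho B w⟩ by rewrite inner_norm exprn_ge0.
rewrite nB subr_ge0 !inner_norm ler_pXn2r ?nnegrE//.
rewrite (star_rep_scale _ srho CA I) normrZ gtr0_norm// /k.
by rewrite mulrC ler_pdivrMr// mulrC.
Qed.

End CstarAlgebras.

(** * Free creation operators on the full Fock space *)

Section FullFock.
Variables (R : realType) (K : hilbertType R) (FK : full_fock K).

Lemma ffock_inner_nil : ⟨ffock_ten FK [::], ffock_ten FK [::]⟩ = 1.
Proof. by rewrite ffock_inner eqxx big_ord0. Qed.

Lemma ffock_inner_nilcons f fs : ⟨ffock_ten FK [::], ffock_ten FK (f :: fs)⟩ = 0.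
Proof. by rewrite ffock_inner. Qed.

Lemma ffock_inner_cons f fs g gs :
  ⟨ffock_ten FK (f :: fs), ffock_ten FK (g :: gs)⟩ =
  ⟨f, g⟩ * ⟨ffock_ten FK fs, ffock_ten FK gs⟩.
Proof.
rewrite !ffock_inner /= eqSS; case: ifP => _; last by rewrite mulr0.
by rewrite big_ord_recl.
Qed.

(** Prepending [f] multiplies the Gram matrix of the elementary tensors by
    [<f, f>], so it extends to a bounded operator. *)
Lemma ffock_crP f : (exists c, bounded_by c (ffock_cr FK f)) /\
  forall fs, ffock_cr FK f (ffock_ten FK fs) = ffock_ten FK (f :: fs).
Proof.
rewrite /ffock_cr; set P := [set _ | _].
suff [/bounded_op_by ? ?] : P (get P) by [].
apply: getPex.
have [|A bA hA] := @isometric_extension _ _ _ _ (ffock_ten FK)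
  (fun fs => ffock_ten FK (f :: fs)) `|f| (normr_ge0 _) (ffock_total FK).
  by move=> fs gs; rewrite ffock_inner_cons inner_norm.
by exists A; split=> //; exact: bounded_by_op bA.
Qed.

End FullFock.

(** * Wold decomposition of a family of free isometries *)

Section Wold.
Variables (R : realType) (K V : hilbertType R) (FK : full_fock K) (L : K -> V -> V).
Hypothesis L_bounded : forall f, exists c, bounded_by c (L f).
Hypothesis L_inner : forall f g u v, ⟨L f u, L g v⟩ = ⟨f, g⟩ * ⟨u, v⟩.
Hypothesis L_adjoint : forall f, exists B, adjoint (L f) B.

Let C : set (V -> V) :=
  smallest (@Cstar_subalgebra R V) ([set idfun] `|` range L).

(** Such a vector plays the role of the vacuum: the adjoints of all [L f] kill
    it. *)
Definition wandering (x : V) : Prop :=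
  ⟨x, x⟩ = 1 /\ forall f v, ⟨x, L f v⟩ = 0.

Lemma gen_bounded A : ([set idfun] `|` range L) A -> bounded_op A.
Proof.
case=> [->|[f _ <-]]; first exact: bounded_by_op (bounded_by_id V).
by have [c hc] := L_bounded f; exact: bounded_by_op hc.
Qed.

Lemma gen_Cstar : Cstar_subalgebra C.
Proof. exact/smallest_Cstar/gen_bounded. Qed.

Lemma gen_id : C idfun.
Proof. by move=> S [_ GS]; apply: GS; left. Qed.

Lemma gen_L f : C (L f).
Proof. by move=> S [_ GS]; apply: GS; right; exists f. Qed.

Lemma gen_adjoint A A' : C A -> adjoint A A' -> C A'.
Proof.
move=> CA AA'; have [cb _ _ ca _] := gen_Cstar; apply: (ca A) => //.
by have [b hb] := bounded_op_by (cb _ CA); exact: bounded_by_op (adjoint_bounded hb AA').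
Qed.

Lemma gen_word x fs : exists2 A, C A & A x = foldr L x fs.
Proof.
have [_ _ cc _ _] := gen_Cstar.
elim: fs => [|f fs [A CA Ax]]; first by exists idfun => //; exact: gen_id.
by exists (L f \o A); [apply: cc => //; exact: gen_L | rewrite /= Ax].
Qed.

(** Creation operators cancel in pairs, and what is left over on one side is
    killed by the wandering vector of the other side. *)
Lemma words_inner x y fs gs : wandering x -> wandering y ->
  ⟨foldr L x fs, foldr L y gs⟩ = ⟨x, y⟩ * ⟨ffock_ten FK fs, ffock_ten FK gs⟩.
Proof.
move=> [_ wx] [_ wy]; elim: fs gs => [|f fs IH] [|g gs] /=.
- by rewrite ffock_inner_nil mulr1.
- by rewrite wx ffock_inner_nilcons mulr0.
- by rewrite !(inner_sym0 (wy _ _)) (inner_sym0 (ffock_inner_nilcons _ _ _)) mulr0.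
- by rewrite L_inner ffock_inner_cons IH mulrCA.
Qed.

Lemma wandering_isometry x : wandering x -> exists Phi : FK -> V,
  [/\ bounded_by 1 Phi, forall fs, Phi (ffock_ten FK fs) = foldr L x fs &
      forall u v, ⟨Phi u, Phi v⟩ = ⟨u, v⟩].
Proof.
move=> wx; have [|Phi bP hP] := @isometric_extension _ _ _ _ (ffock_ten FK)
  (foldr L x) 1 ler01 (ffock_total FK).
  by move=> fs gs; rewrite (words_inner fs gs wx wx) wx.1 expr1n.
exists Phi; split=> // u v.
rewrite (@inner_rel_total _ _ _ _ _ Phi Phi 1 _ bP bP (ffock_total FK)) ?mul1r//.
by move=> _ _ [fs _ <-] [gs _ <-]; rewrite !hP (words_inner fs gs wx wx) wx.1.
Qed.

Variable rho : (V -> V) -> FK -> FK.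
Hypothesis rho_rep : star_rep C setT rho.
Hypothesis rho_L : forall f, rho (L f) = ffock_cr FK f.

Section OneVector.
Variables (x : V) (Phi : FK -> V).
Hypothesis wx : wandering x.
Hypothesis bP : bounded_by 1 Phi.
Hypothesis PhiE : forall fs, Phi (ffock_ten FK fs) = foldr L x fs.
Hypothesis iP : forall u v, ⟨Phi u, Phi v⟩ = ⟨u, v⟩.

Let lP : linear Phi. Proof. by case: bP. Qed.

Lemma range_Phi_closed : closed_subspace (range Phi).
Proof. exact: isometry_range_closed. Qed.

(** On the norm closure the relation is preserved because [rho] is continuous.
    For the adjoint [B] of [L f] it follows from the one for [L f], once [B] is
    known to map the range of [Phi] into itself: both sides then have the same
    inner products with all vectors of that range. *)
Lemma Phi_intertwines A : C A -> exists A', [/\ C A', adjoint A A' &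
  (forall w, Phi (rho A w) = A (Phi w)) /\ (forall w, Phi (rho A' w) = A' (Phi w))].
Proof.
pose P A A' := [/\ C A, C A', adjoint A A' &
  (forall w, Phi (rho A w) = A (Phi w)) /\ (forall w, Phi (rho A' w) = A' (Phi w))].
have cC := gen_Cstar; have [cb cl cc ca clim] := cC.
have [_ _ rid rc radj] := rho_rep.
suff ind : C A -> exists A', P A A' by move=> /ind[A' [_ ? ? ?]]; exists A'.
apply: (@Cstar_ind _ _ _ P) => {A}.
- by move=> A A' [CA _ AA' _]; split=> //; exact: cb.
- by move=> A A' [? ? AA' [? ?]]; split=> //; exact: adjoint_sym.
- move=> a A A' B B' [CA CA' AA' [hA hA']] [CB CB' BB' [hB hB']]; split.
  + exact: cl.
  + exact: cl.
  + exact: adjoint_comb.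
  + split=> w; first by have [-> _] := rc a A B w CA CB I; rewrite lP hA hB.
    by have [-> _] := rc a^* A' B' w CA' CB' I; rewrite lP hA' hB'.
- move=> A A' B B' [CA CA' AA' [hA hA']] [CB CB' BB' [hB hB']]; split.
  + exact: cc.
  + exact: cc.
  + exact: adjoint_comp.
  + split=> w; first by have [_ ->] := rc 0 A B w CA CB I; rewrite hA hB.
    by have [_ ->] := rc 0 B' A' w CB' CA' I; rewrite hB' hA'.
- move=> A A' bA bA' AA' h.
  have CA : C A.
    by apply: clim => // eps ep; have [B [B' [[CB _ _ _] AB _]]] := h eps ep; exists B.
  have CA' : C A' by exact: gen_adjoint CA AA'.
  split=> //.
  have lim D : (forall eps : R[i], 0 < eps -> exists B B', [/\ C B, C B',
        adjoint B B', forall w, Phi (rho B w) = B (Phi w) &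
        forall v, `|D v - B v| <= eps * `|v|]) -> C D -> (exists D', C D' /\ adjoint D D') ->
      forall w, Phi (rho D w) = D (Phi w).
    move=> hD CD [D' [CD' DD']] w; apply/eqP; rewrite -subr_eq0 -normr_eq0 eq_le normr_ge0 andbT.
    apply: (@ler_all_eps _ _ _ (2 * `|w| + `|w|)) => // eps ep.
    have [B [B' [CB CB' BB' hB DB]]] := hD eps ep.
    rewrite add0r -(subrK (Phi (rho B w)) (Phi (rho D w))) -addrA.
    rewrite (le_trans (ler_normD _ _))// mulrDl lerD//; last first.
      by rewrite hB distrC (le_trans (DB _))// (isometry_norm iP) mulrC.
    rewrite -(linear_funB _ _ lP) (isometry_norm iP).
    have -> : rho D w - rho B w = rho (fun v => (-1) *: B v + D v) w.
      by have [-> _] := rc (-1) B D w CB CD I; rewrite scaleN1r addrC.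
    rewrite mulrAC; apply: (@rep_norm_le _ _ _ C rho _ (fun v => (-1)^* *: B' v + D' v)) => //.
    + exact: gen_id.
    + exact: cl.
    + exact: cl.
    + exact: adjoint_comb.
    + by move=> v; rewrite scaleN1r addrC; exact: DB.
  split; apply: lim => //.
  + move=> eps ep; have [B [B' [[CB CB' BB' [hB hB']] AB AB']]] := h eps ep.
    by exists B, B'.
  + by exists A'.
  + move=> eps ep; have [B [B' [[CB CB' BB' [hB hB']] AB AB']]] := h eps ep.
    by exists B', B; split=> //; exact: adjoint_sym.
  + by exists A; split=> //; exact: adjoint_sym.
- move=> _ [->|[f _ <-]].
    exists idfun; split=> //; try exact: gen_id.
    by split=> w; rewrite rid.
  have [B LB] := L_adjoint f; exists B.
  have CB : C B by exact: gen_adjoint (gen_L f) LB.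
  have hL w : Phi (rho (L f) w) = L f (Phi w).
    rewrite rho_L; have [[c bcr] crE] := ffock_crP FK f.
    have [cL bL] := L_bounded f.
    move: w; apply: (eq_on_total (bounded_by_comp bP bcr) (bounded_by_comp bL bP) (ffock_total FK)).
    by move=> _ [fs _ <-] /=; rewrite crE !PhiE.
  have rB w : range Phi (B (Phi w)).
    have [cL bL] := L_bounded f.
    have bB := adjoint_bounded bL LB.
    apply: (total_ind (ffock_total FK)
      (closed_subspace_preimage (bounded_by_comp bB bP) range_Phi_closed)).
    move=> _ [[|g fs] _ <-] /=; rewrite PhiE /=.
      exists 0 => //; rewrite (linear_fun0 lP); apply: inner_ext => v.
      by rewrite inner0r -LB (inner_sym0 (wx.2 f v)).
    exists (⟨f, g⟩ *: ffock_ten FK fs) => //.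
    have [_ lB _] := bounded_by_comp bB bP.
    rewrite -[_ *: _]addr0 lP (linear_fun0 lP) addr0 PhiE; apply: inner_ext => v.
    by rewrite innerZr -LB L_inner.
  split=> //; first exact: gen_L.
  split=> // w; have [z _ hz] := rB w; rewrite -hz; congr Phi.
  apply: inner_ext => y; rewrite -(radj (L f) B)//; last exact: gen_L.
  by rewrite -iP hL -[RHS]iP hz LB.
Qed.

(** The vacuum is sent to [x]; the range of [Phi] is invariant under [C] by the
    intertwining relation, and the words in the creation operators belong to
    [C]. *)
Lemma cyclic_space_range : cyclic_space C x = range Phi.
Proof.
have Px : Phi (ffock_ten FK [::]) = x by rewrite PhiE.
apply/seteqP; split.
  apply: (closed_span_sub range_Phi_closed) => _ [A CA <-].
  have [A' [_ _ [hA _]]] := Phi_intertwines CA.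
  by exists (rho A (ffock_ten FK [::])) => //; rewrite hA Px.
move=> _ [w _ <-].
have := closed_subspace_preimage bP (closed_span_subspace [set A x | A in C]) => cM.
apply: (total_ind (ffock_total FK) cM) => _ [fs _ <-] /=; rewrite PhiE.
by apply: sub_closed_span; have [A CA <-] := gen_word x fs; exists A.
Qed.

Lemma cyclic_invariant A u : C A -> cyclic_space C x u -> cyclic_space C x (A u).
Proof.
move=> CA; rewrite cyclic_space_range => -[w _ <-].
by have [A' [_ _ [hA _]]] := Phi_intertwines CA; exists (rho A w).
Qed.

Lemma pi_cycE A u : cyclic_space C x u -> pi_cyc C x A u = A u.
Proof. by move=> Mu; rewrite /pi_cyc /patch mem_set. Qed.

Lemma pi_cyc_rep : star_rep C (cyclic_space C x) (pi_cyc C x).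
Proof.
have cM := closed_span_subspace [set A x | A in C].
have [M0 Ml _] := cM; have [cb cl cc ca _] := gen_Cstar.
split=> //.
- move=> A CA; have [c [_ lA bA]] := bounded_op_by (cb A CA); split.
  + by move=> w Mw; rewrite pi_cycE//; exact: cyclic_invariant.
  + by move=> a u v Mu Mv; rewrite !pi_cycE ?lA//; exact: Ml.
  + by exists c => w Mw; rewrite pi_cycE.
- by move=> w Mw; rewrite pi_cycE.
- move=> a A B w CA CB Mw; rewrite !pi_cycE//.
  exact: cyclic_invariant.
- by move=> A B w w' CA CB AB Mw Mw'; rewrite !pi_cycE.
Qed.

Lemma pi_cyc_equiv :
  unitarily_equivalent C (cyclic_space C x) (pi_cyc C x) setT rho.
Proof.
have Pinj u v : Phi u = Phi v -> u = v.
  by move=> uv; apply: inner_ext => w; rewrite -iP uv iP.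
have [U hU] : exists U : V -> FK, forall w, U (Phi w) = w.
  have : forall v, exists w, range Phi v -> Phi w = v.
    move=> v; have [[w _ <-]|nv] := pselect (range Phi v); first by exists w.
    by exists 0.
  move=> /choice[U hU]; exists U => w; apply: Pinj; apply: hU.
  by exists w.
rewrite cyclic_space_range; exists U.
  split.
  - by apply/seteqP; split=> // w _; exists (Phi w) => //; exists w.
  - by move=> c _ _ [u _ <-] [v _ <-]; rewrite -lP !hU.
  - by move=> _ _ [u _ <-] [v _ <-]; rewrite !hU iP.
move=> A _ CA [w _ <-]; rewrite pi_cycE; last by rewrite cyclic_space_range; exists w.
by have [A' [_ _ [hA _]]] := Phi_intertwines CA; rewrite hU -hA hU.
Qed.

End OneVector.

(** Everything is transported by the isometries [Phi] of the single wandering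
    vectors.  Orthogonal projections commute with [C] because both the cyclic
    spaces and, by passing to adjoints, their complements are invariant. *)
Theorem wold_decomposition (D : set V) :
  (forall x, D x -> wandering x) ->
  (forall x y, D x -> D y -> x <> y -> ⟨x, y⟩ = 0) ->
  closed_span [set foldr L x fs | x in D & fs in setT] = setT ->
  [/\ direct_sum D (cyclic_space C),
      forall x, D x -> unitarily_isomorphic (cyclic_space C x) [set: FK],
      rep_direct_sum C (@pi_def V) D (cyclic_space C) (pi_cyc C) &
      forall x, D x ->
        unitarily_equivalent C (cyclic_space C x) (pi_cyc C x) [set: FK] rho].
Proof.
move=> wD oD tD.
have cM x : closed_subspace (cyclic_space C x).
  exact: closed_span_subspace.
have orth x y u v : D x -> D y -> x <> y ->
    cyclic_space C x u -> cyclic_space C y v -> ⟨u, v⟩ = 0.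
  move=> Dx Dy xy.
  have [P [bP PE iP]] := wandering_isometry (wD x Dx).
  have [Q [bQ QE iQ]] := wandering_isometry (wD y Dy).
  rewrite (cyclic_space_range (wD x Dx) bP PE iP) (cyclic_space_range (wD y Dy) bQ QE iQ).
  move=> [a _ <-] [b _ <-].
  rewrite (inner_rel_total (k := 0) bP bQ (ffock_total FK)) ?mul0r//.
  move=> _ _ [fs _ <-] [gs _ <-].
  by rewrite PE QE (words_inner fs gs (wD x Dx) (wD y Dy)) oD// !mul0r.
have tot : closed_span (\bigcup_(x in D) cyclic_space C x) = setT.
  apply: (total_sub tD) => _ [x Dx [fs _ <-]]; apply: sub_closed_span.
  by exists x => //; apply: sub_closed_span; have [A CA <-] := gen_word x fs; exists A.
have dD : direct_sum D (cyclic_space C) by split.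
have equiv x : D x ->
    unitarily_equivalent C (cyclic_space C x) (pi_cyc C x) setT rho.
  move=> Dx; have [P [bP PE iP]] := wandering_isometry (wD x Dx).
  exact: pi_cyc_equiv (wD x Dx) bP PE iP.
split=> //; first by move=> x /equiv[U hU _]; exists U.
split=> // [x Dx|A w x CA Dx].
  have [P [bP PE iP]] := wandering_isometry (wD x Dx).
  exact: pi_cyc_rep (wD x Dx) bP PE iP.
have [P [bP PE iP]] := wandering_isometry (wD x Dx).
have [A' [CA' AA' _]] := Phi_intertwines (wD x Dx) bP PE iP CA.
have inv B u := @cyclic_invariant _ _ (wD x Dx) bP PE iP B u.
have [|p Mp hp] := orth_proj_exists (cM x) tot _ w.
  move=> v [y Dy My]; have [xy|xy] := pselect (x = y).
    by exists v; rewrite ?xy// => u _; rewrite subrr inner0r.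
  exists 0; first by case: (cM x).
  by move=> u Mu; rewrite subr0; exact: (orth x y).
have [_ lA] : True /\ linear A by have [cb _ _ _ _] := gen_Cstar; case: (cb A CA).
rewrite (orth_projE (cM x) Mp hp) pi_cycE//.
apply: orth_projE => //; first exact: inv.
move=> u Mu; rewrite /pi_def -(linear_funB _ _ lA) -(adjoint_sym AA').
by apply: hp; exact: inv.
Qed.

End Wold.

(** * Permanents and symmetric products *)

Section SumOverPermutations.

(** Injectivity is checked on the image of 0 and on the rest; surjectivity is then
    the identity [(n+1)! = (n+1) n!]. *)
Lemma lift_perm_bij n :
  bijective (fun p : 'I_n.+1 * 'S_n => lift_perm ord0 p.1 p.2).
Proof.
apply: inj_card_bij => [[i s] [j t] /permP /= st|]; last first.
  by rewrite card_prod card_ord !card_Sn factS.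
have ij : i = j by have := st ord0; rewrite !lift_perm_id.
subst j; congr (_, _); apply/permP => k.
by have := st (lift ord0 k); rewrite !lift_perm_lift => /lift_inj.
Qed.

Lemma sum_perm_recl (R : ringType) n (G : 'I_n.+1 -> 'I_n.+1 -> R) :
  \sum_(s : 'S_n.+1) \prod_i G i (s i) =
  \sum_j G ord0 j * \sum_(s : 'S_n) \prod_i G (lift ord0 i) (lift j (s i)).
Proof.
rewrite (reindex _ (onW_bij _ (lift_perm_bij n))) /=.
under [RHS]eq_bigr do rewrite mulr_sumr.
rewrite pair_big /=; apply: eq_bigr => -[j s] _ /=.
rewrite big_ord_recl lift_perm_id; congr (_ * _).
by apply: eq_bigr => i _; rewrite lift_perm_lift.
Qed.

End SumOverPermutations.

Section DeleteNth.
Variable T : Type.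

Definition del (j : nat) (s : seq T) := take j s ++ drop j.+1 s.

Lemma size_del j s n : (j < n.+1)%N -> size s = n.+1 -> size (del j s) = n.
Proof.
move=> jn sn; rewrite size_cat size_drop size_take sn jn.
by rewrite subSS subnKC.
Qed.

Lemma nth_del x0 j s i : (j < size s)%N -> nth x0 (del j s) i = nth x0 s (bump j i).
Proof.
move=> js; rewrite nth_cat size_take js /bump; case: ltnP => ij.
  by rewrite nth_take.
by rewrite nth_drop addSn subnKC.
Qed.

End DeleteNth.

Lemma map_del T U (f : T -> U) j s : map f (del j s) = del j (map f s).
Proof. by rewrite /del map_cat map_take map_drop. Qed.

Lemma perm_del (T : eqType) (x0 : T) j s : (j < size s)%N ->
  perm_eq s (nth x0 s j :: del j s).
Proof.
move=> js; rewrite /del -cat1s perm_sym perm_catCA /= -drop_nth//.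
by rewrite cat_take_drop.
Qed.

Section SymmetricFock.
Variables (R : realType) (V : hilbertType R) (F : full_fock V) (Gam : sym_fock F).
Implicit Types (u v : V) (us vs : seq V).

Lemma symmetrizationE n us : size us = n ->
  symmetrization F us = (n`!%:R : R[i])^-1 *:
    \sum_(s : 'S_n) ffock_ten F [seq us`_(s i) | i : 'I_n].
Proof. by move=> <-. Qed.

Lemma nth_image0 n (f : 'I_n -> V) (i : 'I_n) : [seq f j | j : 'I_n]`_i = f i.
Proof.
by rewrite (nth_map i) ?size_enum_ord// nth_ord_enum.
Qed.

Lemma size_image0 n (f : 'I_n -> V) : size [seq f j | j : 'I_n] = n.
Proof. by rewrite size_map size_enum_ord. Qed.

Lemma ffock_inner_n n us vs : size us = n -> size vs = n ->
  ⟨ffock_ten F us, ffock_ten F vs⟩ = \prod_(i < n) ⟨us`_i, vs`_i⟩.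
Proof. by move=> <- e; rewrite ffock_inner e eqxx. Qed.

Lemma symmetrization_perm us vs : perm_eq us vs ->
  symmetrization F us = symmetrization F vs.
Proof.
move=> p; rewrite (symmetrizationE (perm_size p)) [RHS](symmetrizationE erefl).
have /tuple_permP[q uq] : perm_eq us (in_tuple vs) by [].
congr (_ *: _); rewrite [RHS](reindex_inj (mulIg q)) /=; apply: eq_bigr => s _.
congr ffock_ten; apply: eq_map => i; rewrite uq permM.
by rewrite -[RHS](tnth_nth 0 (in_tuple vs)) -tnth_nth tnth_mktuple.
Qed.

(** One of the two averages over the symmetric group is absorbed by a translation
    of the other. *)
Lemma sfock_inner n us vs : size us = n -> size vs = n ->
  ⟨sfock_sym Gam us, sfock_sym Gam vs⟩ =
  (n`!%:R)^-1 * \sum_(s : 'S_n) \prod_(i < n) ⟨us`_i, vs`_(s i)⟩.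
Proof.
move=> un vn; rewrite -sfock_incl_inner !sfock_incl_sym.
rewrite (symmetrizationE un) (symmetrizationE vn) innerZl innerZr inner_suml.
rewrite conj_Creal ?rpredV ?realn//; congr (_ * _).
transitivity ((n`!%:R)^-1 * \sum_(s : 'S_n) \sum_(t : 'S_n) \prod_(i < n) ⟨us`_i, vs`_(t i)⟩).
  congr (_ * _); apply: eq_bigr => s _; rewrite inner_sumr.
  rewrite (reindex_inj (mulgI s)) /=; apply: eq_bigr => t _.
  rewrite (ffock_inner_n (size_image0 _) (size_image0 _)) [RHS](reindex_inj (@perm_inj _ s)) /=.
  by apply: eq_bigr => i _; rewrite !nth_image0 permM.
rewrite sumr_const card_Sn -[X in _ * X]mulr_natl mulrA mulVf ?mul1r//.
Qed.

Lemma sfock_inner_size us vs : size us != size vs ->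
  ⟨sfock_sym Gam us, sfock_sym Gam vs⟩ = 0.
Proof.
move=> uv; rewrite -sfock_incl_inner !sfock_incl_sym innerZl innerZr.
rewrite inner_suml big1 ?mulr0// => s _; rewrite inner_sumr big1// => t _.
by rewrite ffock_inner !size_image0 (negPf uv).
Qed.

(** The symmetric products rescaled so that creation operators act on them
    without any numerical factor; their inner products are permanents. *)
Definition nsym us : Gam := sqrtC ((size us)`!%:R : R[i]) *: sfock_sym Gam us.

Lemma sqrt_fact_gt0 n : 0 < sqrtC (n`!%:R : R[i]).
Proof. by rewrite sqrtC_gt0 ltr0n fact_gt0. Qed.

Lemma sfock_nsym us : sfock_sym Gam us = (sqrtC ((size us)`!%:R))^-1 *: nsym us.
Proof. by rewrite scalerA mulVf ?scale1r// gt_eqF// sqrt_fact_gt0. Qed.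

Lemma nsym_inner n us vs : size us = n -> size vs = n ->
  ⟨nsym us, nsym vs⟩ = \sum_(s : 'S_n) \prod_(i < n) ⟨us`_i, vs`_(s i)⟩.
Proof.
move=> un vn; rewrite innerZl innerZr (sfock_inner un vn) un vn.
rewrite conj_Creal ?gtr0_real ?sqrt_fact_gt0// mulrA -expr2 sqrtCK mulrA.
by rewrite mulfV ?mul1r// pnatr_eq0 -lt0n fact_gt0.
Qed.

Lemma nsym_inner_size us vs : size us != size vs -> ⟨nsym us, nsym vs⟩ = 0.
Proof. by move=> uv; rewrite innerZl innerZr sfock_inner_size// !mulr0. Qed.

(** The expansion of the permanent along the row of [u].  Both sides vanish when
    the particle numbers do not match. *)
Lemma nsym_inner_cons u us vs : ⟨nsym (u :: us), nsym vs⟩ =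
  \sum_(j < size vs) ⟨u, vs`_j⟩ * ⟨nsym us, nsym (del j vs)⟩.
Proof.
have [e|ne] := eqVneq (size us).+1 (size vs); last first.
  rewrite nsym_inner_size// big1// => j _; rewrite nsym_inner_size ?mulr0//.
  apply: contraNneq ne => ->; case: vs j => [[]//|v vs] j.
  by rewrite (@size_del _ j _ (size vs)).
rewrite (@nsym_inner (size us).+1)//.
rewrite (sum_perm_recl (fun i j => ⟨(u :: us)`_i, vs`_j⟩)) /= -e.
apply: eq_bigr => j _; congr (_ * _).
rewrite (@nsym_inner (size us))//; last exact: size_del.
apply: eq_bigr => s _; apply: eq_bigr => i _.
by rewrite nth_del// -e.
Qed.

Lemma nsym_inner_consr u us vs : ⟨nsym vs, nsym (u :: us)⟩ =
  \sum_(j < size vs) ⟨vs`_j, u⟩ * ⟨nsym (del j vs), nsym us⟩.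
Proof.
rewrite inner_conj nsym_inner_cons rmorph_sum /=; apply: eq_bigr => j _.
by rewrite rmorphM /= -!inner_conj.
Qed.

Lemma nsym_perm us vs : perm_eq us vs -> nsym us = nsym vs.
Proof.
move=> p; rewrite /nsym (perm_size p); congr (_ *: _).
apply: inner_ext => w; rewrite -!sfock_incl_inner !sfock_incl_sym.
by rewrite (symmetrization_perm p).
Qed.

Lemma nsym_total : closed_span (range nsym) = setT.
Proof.
apply: (total_sub (sfock_total Gam)) => _ [us _ <-]; rewrite sfock_nsym.
apply: (closed_subspaceZ _ (closed_span_subspace _)).
by apply: sub_closed_span; exists us.
Qed.

Lemma nsym_linear us : linear (fun u => nsym (u :: us)).
Proof.
move=> c u v; apply: (eq_inner_total nsym_total) => _ [vs _ <-].
rewrite inner_linear !nsym_inner_consr mulr_sumr -big_split /=.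
by apply: eq_bigr => j _; rewrite inner_linear mulrDl mulrA.
Qed.

Lemma ffock_norm us : `|ffock_ten F us| = \prod_(i < size us) `|us`_i|.
Proof.
apply/eqP; rewrite -(@eqrXn2 _ 2)// ?prodr_ge0// -inner_norm ffock_inner eqxx.
by rewrite -prodrXl; apply/eqP; apply: eq_bigr => i _; rewrite inner_norm.
Qed.

Lemma sfock_norm_le us : `|sfock_sym Gam us| <= \prod_(i < size us) `|us`_i|.
Proof.
rewrite -(isometry_norm (@sfock_incl_inner _ _ _ Gam)) sfock_incl_sym.
rewrite normrZ normfV normr_nat ler_pdivrMl ?ltr0n ?fact_gt0//.
rewrite (le_trans (ler_norm_sum _ _ _))// mulr_natl -card_Sn -sumr_const.
apply: ler_sum => s _; rewrite ffock_norm.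
rewrite size_image0 [X in _ <= X](reindex_inj (@perm_inj _ s)) /=.
by rewrite le_eqVlt; apply/orP; left; apply/eqP; apply: eq_bigr => i _; rewrite nth_image0.
Qed.

Lemma nsym_bounded us : exists c, bounded_by c (fun u => nsym (u :: us)).
Proof.
exists (sqrtC ((size us).+1`!%:R) * \prod_(i < size us) `|us`_i|); split.
- by rewrite mulr_ge0 ?prodr_ge0// ltW// sqrt_fact_gt0.
- exact: nsym_linear.
- move=> u; rewrite normrZ gtr0_norm ?sqrt_fact_gt0// -mulrA.
  rewrite ler_wpM2l ?(ltW (sqrt_fact_gt0 _))// (le_trans (sfock_norm_le _))//.
  by rewrite /= big_ord_recl /= mulrC.
Qed.

(** The letters of an arbitrary product are replaced one after the other, by
    linearity and continuity in each of them; symmetry allows to treat only the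
    first one. *)
Lemma nsym_map_total (I : Type) (phi : I -> V) : closed_span (range phi) = setT ->
  closed_span (range (fun s : seq I => nsym (map phi s))) = setT.
Proof.
move=> tphi; set S := range _; have cS := closed_span_subspace S.
suff all_in us s : closed_span S (nsym (us ++ map phi s)).
  apply: (total_sub nsym_total) => _ [us _ <-].
  by have := all_in us [::]; rewrite cats0.
elim: us s => [|u us IH] s; first by apply: sub_closed_span; exists s.
have [c bc] := nsym_bounded (us ++ map phi s).
apply: (total_ind tphi (closed_subspace_preimage bc cS)) => _ [p _ <-] /=.
rewrite (@nsym_perm _ (us ++ map phi (p :: s))); first exact: IH.
by rewrite /= -cat1s perm_catCA.
Qed.

(** By the expansion of the permanent: a letter of [s] can only be paired with a
    letter of [t] that has the same label. *)
Lemma nsym_orth (I : Type) (T : eqType) (phi : I -> V) (lab : I -> T) s t :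
  (forall a b, lab a != lab b -> ⟨phi a, phi b⟩ = 0) ->
  ~~ perm_eq (map lab s) (map lab t) ->
  ⟨nsym (map phi s), nsym (map phi t)⟩ = 0.
Proof.
move=> orth; elim: s t => [|a s IH] t /= st.
  by apply: nsym_inner_size; case: t st.
rewrite nsym_inner_cons big1// => -[j jt] _ /=; rewrite size_map in jt.
rewrite (nth_map a)//.
have [e|ne] := eqVneq (lab a) (lab (nth a t j)); last by rewrite orth ?mul0r.
rewrite -map_del IH ?mulr0//; apply: contraNN st => p.
have jt' : (j < size (map lab t))%N by rewrite size_map.
rewrite perm_sym (permPl (perm_del (lab a) jt')) (nth_map a)// -e perm_cons.
by rewrite -map_del perm_sym.
Qed.

(** The creation operator is well defined on the algebraic Fock space since its
    formal adjoint, the annihilation operator read off from the expansion of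
    [<nsym vs, nsym (u :: us)>], is defined on a total set. *)
Lemma boson_creationP u :
  linear_on (lin_span (range (sfock_sym Gam))) (boson_creation Gam u) /\
  forall vs, boson_creation Gam u (sfock_sym Gam vs) =
    sqrtC (size vs).+1%:R *: sfock_sym Gam (u :: vs).
Proof.
rewrite /boson_creation; set P := [set _ | _]; suff : P (get P) by [].
apply: getPex.
apply: (@linear_on_span_exists _ _ _ _ _ _ _ nsym_total) => _ [vs _ <-].
exists (\sum_(j < size vs) (⟨vs`_j, u⟩)^* *: nsym (del j vs)) => us.
have n0 : sqrtC ((size us)`!%:R : R[i]) != 0 by rewrite gt_eqF ?sqrt_fact_gt0.
apply: (mulfI n0); rewrite -!innerZr -/(nsym us) scalerA.
have -> : sqrtC ((size us)`!%:R) * sqrtC (size us).+1%:R = sqrtC ((size us).+1`!%:R) :> R[i].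
  by rewrite -sqrtCM ?nnegrE ?ler0n// -natrM mulnC -factS.
rewrite -[X in ⟨_, X⟩]/(nsym (u :: us)) nsym_inner_consr inner_suml.
by apply: eq_bigr => j _; rewrite [RHS]innerZl conjCK.
Qed.

End SymmetricFock.

(** * The extended free creation operators *)

Section OneBasedMax.

(** The largest label of a word, where the number [k] stands for the label [k + 1],
    and 0 for the empty word: this is the convention [k_0 = 0]. *)
Definition top (ks : seq nat) : nat := \max_(k <- ks) k.+1.

Lemma top_perm ks ks' : perm_eq ks ks' -> top ks = top ks'.
Proof. exact: perm_big. Qed.

Lemma top_cons k ks : top (k :: ks) = maxn k.+1 (top ks).
Proof. exact: big_cons. Qed.

Lemma le_top k ks : k \in ks -> (k < top ks)%N.
Proof. by move=> kks; rewrite /top (big_rem k kks) /= leq_max leqnn. Qed.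

Lemma top_cons_top ks : top (top ks :: ks) = (top ks).+1.
Proof. by rewrite top_cons; apply/maxn_idPl. Qed.

Lemma top_attained ks m : (m < top ks)%N -> exists2 k, k \in ks & (m <= k)%N.
Proof.
elim: ks => [|k ks IH]; first by rewrite /top big_nil.
rewrite top_cons leq_max => /orP[mk|/IH[k' kks mk]].
  by exists k; rewrite ?mem_head.
by exists k'; rewrite // in_cons kks orbT.
Qed.

End OneBasedMax.

Section ExtendedFreeCreation.
Variables (R : realType) (K G : hilbertType R) (e : nat -> G).
Hypothesis he : orthonormal_basis [set k : nat | (1 <= k)%N] e.
Variables (H : hilbert_tensor K G) (FH : full_fock H) (Gam : sym_fock FH).

(** The label [k] stands for the basis vector [e_(k+1)], so that every natural
    number is a label. *)
Definition vec (p : K * nat) : H := tens H p.1 (e p.2.+1).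

Definition word_vec (s : seq (K * nat)) : Gam := nsym Gam (map vec s).

Definition word_top (s : seq (K * nat)) : nat := top (unzip2 s).

Lemma vec_inner p q : ⟨vec p, vec q⟩ = ⟨p.1, q.1⟩ * (p.2 == q.2)%:R.
Proof. by rewrite tens_inner he.1. Qed.

Lemma word_vec_orth s t : ~~ perm_eq (unzip2 s) (unzip2 t) ->
  ⟨word_vec s, word_vec t⟩ = 0.
Proof.
apply: nsym_orth => a b ab.
by rewrite vec_inner (negPf ab) mulr0.
Qed.

Lemma word_vec_perm s t : perm_eq s t -> word_vec s = word_vec t.
Proof. by move=> p; apply: nsym_perm; exact: perm_map. Qed.

(** A new label exceeding all others by one creates an isometric copy: in the
    expansion of the permanent only the new letters can be paired. *)
Lemma word_vec_create f g s t :
  ⟨word_vec ((f, word_top s) :: s), word_vec ((g, word_top t) :: t)⟩ =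
  ⟨f, g⟩ * ⟨word_vec s, word_vec t⟩.
Proof.
have [st|st] := eqVneq (word_top s) (word_top t); last first.
  rewrite !word_vec_orth ?mulr0//; first by apply: contraNN st => /top_perm st; apply/eqP.
  apply: contraNN st => /= /top_perm; rewrite !top_cons_top => -[st].
  exact/eqP.
rewrite {1}/word_vec /= nsym_inner_cons /= big_ord_recl /=.
rewrite vec_inner /= st eqxx mulr1 [X in _ + X]big1 ?addr0; last first.
  case=> i it _ /=; rewrite size_map in it.
  rewrite (nth_map (g, 0%N))// vec_inner /= (_ : _ == _ = false) ?mulr0 ?mul0r//.
  by apply: gtn_eqF; apply: le_top; apply: map_f; exact: mem_nth.
by rewrite /del take0 drop1.
Qed.

Hypothesis vec_total : closed_span (range vec) = setT.

Lemma word_vec_total : closed_span (range word_vec) = setT.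
Proof. exact: nsym_map_total. Qed.

Lemma boson_creation_word f k s :
  boson_creation Gam (tens H f (e k.+1)) (word_vec s) = word_vec ((f, k) :: s).
Proof.
have [lB hB] := boson_creationP Gam (tens H f (e k.+1)).
pose x (i : 'I_1) := sfock_sym Gam (map vec s).
have Sx i : lin_span (range (sfock_sym Gam)) (x i).
  exists 1%N, (fun=> 1), (fun=> x i); rewrite big_ord1 scale1r.
  by split=> // _; exists (map vec s).
have := linear_on_sum (fun=> sqrtC ((size (map vec s))`!%:R)) lB Sx.
rewrite !big_ord1 hB scalerA => ->; congr (_ *: _) => /=.
by rewrite -sqrtCM ?nnegrE ?ler0n// -natrM mulnC -factS.
Qed.

Let PrM k := closed_span [set sfock_sym Gam us | us in
    [set us : seq H | forall u, u \in us -> Hr e H k u]].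

Let PrM_closed k : closed_subspace (PrM k).
Proof. exact: closed_span_subspace. Qed.

Lemma vec_Hr p k : (p.2 < k)%N -> Hr e H k.+1 (vec p).
Proof.
move=> pk; apply: sub_closed_span; exists p.1, p.2.+1.
by rewrite subn1.
Qed.

Lemma Hr_orth p k u : (k <= p.2)%N -> Hr e H k.+1 u -> ⟨u, vec p⟩ = 0.
Proof.
move=> kp Hu; apply: inner_sym0; move: u Hu.
apply: (closed_span_sub (closed_subspace_orth (vec p))) => _ [f [k' [/andP[k0 k'k] ->]]] /=.
rewrite subn1 /= in k'k.
rewrite tens_inner he.1// (_ : _ == _ = false) ?mulr0//.
by apply: gtn_eqF; rewrite ltnS (leq_trans k'k).
Qed.

(** If all labels are small then the word is in the range of the projection.
    Otherwise it has a letter that is orthogonal to the one-particle space of that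
    range, and moving this letter to the front makes all terms of the expansion
    vanish. *)
Lemma Pr_word_spec k s : exists2 p, PrM k.+1 p &
  p = (if (word_top s <= k)%N then word_vec s else 0) /\
  forall u, PrM k.+1 u -> ⟨u, word_vec s - p⟩ = 0.
Proof.
case: ifP => sk.
  exists (word_vec s); last by split=> // u _; rewrite subrr inner0r.
  apply: (closed_subspaceZ _ (closed_span_subspace _)); apply: sub_closed_span.
  exists (map vec s) => // _ /mapP[p ps ->]; apply: vec_Hr.
  by rewrite (leq_trans _ sk)//; apply: le_top; exact: map_f.
exists 0; first by case: (PrM_closed k.+1).
split=> // u; rewrite subr0 => Mu; apply: inner_sym0; move: u Mu.
apply: (closed_span_sub (closed_subspace_orth _)) => _ [us Hus <-] /=.
apply: inner_sym0; rewrite sfock_nsym innerZl.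
move/negbT: sk; rewrite -ltnNge => /top_attained[_ /mapP[p ps ->] kp].
rewrite (word_vec_perm (perm_to_rem ps)) /word_vec /= nsym_inner_consr.
rewrite big1 ?mulr0// => -[j jus] _ /=.
by rewrite (Hr_orth kp) ?mul0r//; apply: Hus; exact: mem_nth.
Qed.

(** The projection is only known on words, and its value on a combination of words
    comes from the uniqueness of orthogonal projections. *)
Lemma Pr_comb k n (c : 'I_n -> R[i]) (s : 'I_n -> seq (K * nat)) :
  Pr e Gam k (\sum_(i < n) c i *: word_vec (s i)) =
  \sum_(i < n) c i *: (if (word_top (s i) < k)%N then word_vec (s i) else 0).
Proof.
case: k => [|k]; first by rewrite /Pr eqxx big1// => i _; rewrite scaler0.
rewrite /Pr /=; apply: (orth_projE (PrM_closed _)).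
  apply: closed_subspace_sum => [|i]; first exact: PrM_closed.
  by have [p Mp [<- _]] := Pr_word_spec k (s i).
move=> u Mu; rewrite -sumrB inner_sumr big1// => i _.
rewrite -scalerBr innerZr; have [p _ [<- ->]] := Pr_word_spec k (s i) => //.
by rewrite mulr0.
Qed.

Lemma word_lin_span s : lin_span (range (sfock_sym Gam)) (word_vec s).
Proof.
exists 1%N, (fun=> sqrtC ((size (map vec s))`!%:R)), (fun=> sfock_sym Gam (map vec s)).
by rewrite big_ord1; split=> // _; exists (map vec s).
Qed.

Lemma free_cr_summand f k n (c : 'I_n -> R[i]) (s : 'I_n -> seq (K * nat)) :
  let x := \sum_(i < n) c i *: word_vec (s i) in
  boson_creation Gam (tens H f (e k.+1)) (Pr e Gam k.+1 x - Pr e Gam k x) =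
  \sum_(i < n) (if word_top (s i) == k then
     c i *: word_vec ((f, word_top (s i)) :: s i) else 0).
Proof.
move=> x; rewrite !Pr_comb -sumrB.
have [lB _] := boson_creationP Gam (tens H f (e k.+1)).
rewrite (eq_bigr (fun i => (if word_top (s i) == k then c i else 0) *: word_vec (s i))).
  rewrite (linear_on_sum _ lB (fun i => word_lin_span (s i))).
  apply: eq_bigr => i _; rewrite boson_creation_word.
  by case: eqP => [->//|_]; rewrite scale0r.
move=> i _; rewrite -scalerBr ltnS.
case: ltngtP => ik; rewrite ?subrr ?scaler0 ?scale0r//.
by rewrite subr0.
Qed.

(** Each word contributes to exactly one term of the series, so the partial sums
    are eventually constant. *)
Lemma free_cr_partial f N n (c : 'I_n -> R[i]) (s : 'I_n -> seq (K * nat)) :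
  let x := \sum_(i < n) c i *: word_vec (s i) in
  \sum_(1 <= k < N.+1) boson_creation Gam (tens H f (e k))
         (Pr e Gam k x - Pr e Gam k.-1 x) =
  \sum_(i < n) (if (word_top (s i) < N)%N then
     c i *: word_vec ((f, word_top (s i)) :: s i) else 0).
Proof.
move=> x; rewrite big_add1 /=.
under eq_bigr do rewrite free_cr_summand.
rewrite exchange_big /=; apply: eq_bigr => i _.
rewrite -big_mkcond /= (eq_bigl (fun k => k == word_top (s i))) ?big_nat1_eq//.
Qed.

Lemma Gamma0_words x : Gamma0 e Gam x -> exists n (c : 'I_n -> R[i]) (s : 'I_n -> seq (K * nat)),
  x = \sum_(i < n) c i *: word_vec (s i).
Proof.
move=> [n [c [v [hv ->]]]].
have /choice[r hr] : forall i, exists r : R[i] * seq (K * nat), v i = r.1 *: word_vec r.2.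
  move=> i; have [s [/allP s1 _ ->]] := hv i.
  rewrite sfock_nsym.
  exists ((sqrtC ((size [seq tens H p.1 (e p.2) | p <- s])`!%:R))^-1, [seq (p.1, p.2.-1) | p <- s]).
  congr (_ *: nsym _ _); rewrite -map_comp; apply/eq_in_map => p ps /=.
  by rewrite /vec /= prednK// s1.
exists n, (fun i => c i * (r i).1), (fun i => (r i).2).
by apply: eq_bigr => i _; rewrite {1}hr scalerA.
Qed.

(** Sorting the letters by their labels does not change the symmetric product. *)
Lemma words_Gamma0 s : Gamma0 e Gam (word_vec s).
Proof.
pose t := sort (fun p q : K * nat => (p.2 <= q.2)%N) s.
rewrite (@word_vec_perm s t); last by rewrite perm_sym perm_sort.
exists 1%N, (fun=> sqrtC ((size (map vec t))`!%:R)), (fun=> sfock_sym Gam (map vec t)).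
rewrite big_ord1; split=> // _; exists [seq (p.1, p.2.+1) | p <- t]; split.
- by apply/allP => _ /mapP[p _ ->].
- rewrite /unzip2 -map_comp.
  rewrite sorted_map.
  apply: (@sort_sorted _ (fun p q : K * nat => (p.2 <= q.2)%N)) => p q.
  exact: leq_total.
- by rewrite -map_comp.
Qed.

(** Adding the letter [f] with the next label is a multiple of an isometry by
    [word_vec_create]; this bounded operator and the series agree on the total set
    of words, which determines [free_cr]. *)
Lemma free_crP f : (exists c, bounded_by c (free_cr e Gam f)) /\
  forall s, free_cr e Gam f (word_vec s) = word_vec ((f, word_top s) :: s).
Proof.
rewrite /free_cr; set P := [set _ | _].
have [bA cA] : P (get P).
  have [|A bA hA] := @isometric_extension _ _ _ _ word_vec
    (fun s => word_vec ((f, word_top s) :: s)) `|f| (normr_ge0 _) word_vec_total.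
    by move=> s t; rewrite word_vec_create inner_norm.
  apply: getPex; exists A; split; first exact: bounded_by_op bA.
  move=> x /Gamma0_words[n [c [s ->]]]; have [_ lA _] := bA.
  apply: cvg_near_cst; exists (\max_(i < n) word_top (s i)).+1 => // N /= hN.
  rewrite free_cr_partial (linear_fun_sum _ _ lA); apply: eq_bigr => i _.
  by rewrite hA ifT// (leq_ltn_trans _ hN)// leq_bigmax.
split; first exact: bounded_op_by.
move=> s; have := cA _ (words_Gamma0 s).
set u := (X in X @ \oo --> _) => ul.
have : u @ \oo --> word_vec ((f, word_top s) :: s).
  apply: cvg_near_cst; exists (word_top s).+1 => // N /= hN.
  have := free_cr_partial f N (fun _ : 'I_1 => 1) (fun=> s).
  by rewrite /= !big_ord1 !scale1r ifT.
by move: ul => /(cvg_unique _); apply.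
Qed.

Lemma free_cr_inner f g u v :
  ⟨free_cr e Gam f u, free_cr e Gam g v⟩ = ⟨f, g⟩ * ⟨u, v⟩.
Proof.
have [[cf bf] hf] := free_crP f; have [[cg bg] hg] := free_crP g.
apply: (inner_rel_total bf bg word_vec_total) => _ _ [s _ <-] [t _ <-].
by rewrite hf hg word_vec_create.
Qed.

(** The labels of the words that are not produced by a creation operator.  The
    condition does not depend on the order of the letters. *)
Definition irreducible (ks : seq nat) : Prop :=
  forall ks', ~~ perm_eq ks (top ks' :: ks').

Lemma irreducible_orth s f v : irreducible (unzip2 s) ->
  ⟨word_vec s, free_cr e Gam f v⟩ = 0.
Proof.
move=> irr; have [[c bc] hf] := free_crP f.
apply: (total_ind word_vec_total (closed_subspace_preimage bc (closed_subspace_orth (word_vec s)))).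
by move=> _ [t _ <-] /=; rewrite hf word_vec_orth//; exact: irr.
Qed.

(** The letter that carries the top label is moved to the front. *)
Lemma reducible_perm (T : eqType) (s : seq (T * nat)) : ~ irreducible (unzip2 s) ->
  exists g s', perm_eq s ((g, top (unzip2 s')) :: s').
Proof.
move=> /existsNP[ks' /negP]; rewrite negbK => p.
have : top ks' \in unzip2 s by rewrite (perm_mem p) mem_head.
move=> /mapP[q qs kq]; exists q.1, (rem q s).
rewrite (perm_trans (perm_to_rem qs))// -(_ : q.2 = top (unzip2 (rem q s))).
  by rewrite -surjective_pairing.
rewrite -kq; apply: top_perm; rewrite -(perm_cons (top ks')) -(permPl p).
by rewrite kq; exact: (perm_map snd (perm_to_rem qs)).
Qed.

(** A word is either orthogonal to the range of the creation operator or created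
    from a shorter word, and in both cases the value of the adjoint is explicit. *)
Lemma free_cr_adjoint f : exists B, adjoint (free_cr e Gam f) B.
Proof.
have [[c bc] hf] := free_crP f.
apply: (adjoint_exists bc word_vec_total) => _ [s _ <-].
have [irr|/reducible_perm[g [t st]]] := pselect (irreducible (unzip2 s)).
  by exists 0 => v; rewrite inner0r; apply: inner_sym0; exact: irreducible_orth.
have [_ hg] := free_crP g.
exists (⟨f, g⟩ *: word_vec t) => v.
by rewrite (word_vec_perm st) -hg free_cr_inner innerZr.
Qed.

End ExtendedFreeCreation.

(** * Admissible words *)

Section AdmissibleWords.

(** Labels come first: sorting by this order makes both monotonicity conditions on
    admissible words hold. *)
Definition lexle (p q : nat * nat) : bool :=
  (p.2 < q.2)%N || (p.2 == q.2) && (p.1 <= q.1)%N.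

Lemma lexle_total : total lexle.
Proof. by move=> [a b] [a' b']; rewrite /lexle /=; lia. Qed.

Lemma lexle_trans : transitive lexle.
Proof. by move=> [a b] [a' b'] [a'' b'']; rewrite /lexle /=; lia. Qed.

Lemma lexle_anti : antisymmetric lexle.
Proof.
move=> [a b] [a' b']; rewrite /lexle /= => h.
by congr (_, _); move: h; lia.
Qed.

Definition shift_up (w : seq (nat * nat)) := [seq (p.1.+1, p.2.+1) | p <- w].

Lemma sorted_top ks : sorted leq ks -> top ks = last 0%N (map succn ks).
Proof.
case/lastP: ks => [|ks k]; first by rewrite /top big_nil.
rewrite (sorted_pairwise leq_trans) pairwise_rcons => /andP[/allP kmax _].
rewrite map_rcons last_rcons (top_perm (permEl (perm_rcons k ks))) top_cons.
apply/maxn_idPl; rewrite leqNgt; apply/negP => /top_attained[k' /kmax].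
by rewrite ltnNge => ->.
Qed.

(** In a sorted word the top label is the last one, so the letters that a creation
    operator could have added are known. *)
Lemma sorted_irreducible ks k : sorted leq (rcons ks k) ->
  irreducible (rcons ks k) <-> k <> top ks.
Proof.
move=> srt; split.
  by move=> irr e; have := irr ks; rewrite -e perm_rcons perm_refl.
move=> kt t; apply/negP => p; apply: kt.
have := top_perm p; rewrite top_cons_top sorted_top// map_rcons last_rcons => -[e].
rewrite e; apply: top_perm; rewrite -(perm_cons (top t)) -(permPl p).
by rewrite -e perm_rcons.
Qed.

(** Sorting, in [lexle], replaces the conditions on consecutive indices, and
    irreducibility of the multiset of labels replaces the last one, [k_n] not
    being [k_(n-1) + 1]. *)
Lemma admissibleP s : admissible s <->
  exists w, [/\ s = shift_up w, sorted lexle w & irreducible (unzip2 w)].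
Proof.
have nth1 w r : (r < size w)%N ->
    nth 0%N (0%N :: unzip1 (shift_up w)) r.+1 = (nth (0, 0)%N w r).1.+1.
  move=> rw; rewrite /= /unzip1 /shift_up -map_comp.
  by rewrite (nth_map (0, 0)%N).
have nth2 w r : (r < size w)%N ->
    nth 0%N (0%N :: unzip2 (shift_up w)) r.+1 = (nth (0, 0)%N w r).2.+1.
  move=> rw; rewrite /= /unzip2 /shift_up -map_comp.
  by rewrite (nth_map (0, 0)%N).
have sz w : size (shift_up w) = size w by rewrite size_map.
have keys w : unzip2 (shift_up w) = map succn (unzip2 w).
  by rewrite /unzip2 -!map_comp.
have sorted_keys w : sorted lexle w -> sorted leq (unzip2 w).
  by rewrite sorted_map; apply: sub_sorted => p q; rewrite /lexle /=; lia.
have run w : sorted lexle w -> irreducible (unzip2 w) <->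
    let k r := nth 0%N (0%N :: unzip2 (shift_up w)) r in
    ((1 <= size w)%N -> k (size w) <> (k (size w).-1).+1).
  move=> srt; have := sorted_keys w srt; rewrite keys.
  case/lastP: w srt => [|w p] srt.
    by split=> // _ ks; apply/negP => /perm_size.
  rewrite /unzip2 map_rcons -/(unzip2 w) => skeys.
  have -> : irreducible (rcons (unzip2 w) p.2) <-> p.2 <> top (unzip2 w).
    exact: sorted_irreducible.
  rewrite sorted_top; last first.
    by apply: sorted_keys; move: srt; rewrite -cats1 => /cat_sorted2[].
  rewrite size_rcons /= map_rcons nth_rcons size_map size_map ltnn eqxx.
  rewrite -rcons_cons nth_rcons /= !size_map ltnSn.
  have -> : nth 0%N (0%N :: map succn (unzip2 w)) (size w) = last 0%N (map succn (unzip2 w)).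
    by rewrite -[RHS]/(last 0%N (0%N :: _)) -nth_last /= !size_map.
  by split=> [h _ [/h]|h e]; last by apply: h => //; rewrite e.
split.
  move=> [pos le_k le_i stop].
  pose w := [seq (p.1.-1, p.2.-1) | p <- s].
  have sw : s = shift_up w.
    rewrite /shift_up -map_comp -[LHS]map_id; apply/eq_in_map => p ps /=.
    have [j js <-] := nthP (0, 0)%N ps.
    have := pos j.+1 ltac:(by []); rewrite /= /unzip1 /unzip2 !(nth_map (0, 0)%N)//.
    by case: (nth _ _ _) => a b /= [a1 b1]; rewrite !prednK.
  have ws : size w = size s by rewrite size_map.
  exists w.
  have srt : sorted lexle w.
    apply/(sortedP (0, 0)%N) => i iw.
    have i0 : (i < size w)%N by exact: ltnW.
    have := le_k i.+1; have := le_i i.+1.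
    rewrite -ws {}sw !nth1// !nth2// iw /= => /(_ isT) hi /(_ isT) hk.
    by move: hi hk; rewrite /lexle; lia.
  split=> //; apply/(run w srt); move: stop; rewrite -ws.
  by rewrite {1 2}sw.
move=> [w [-> srt irr]]; rewrite /admissible sz; split.
- by case=> // r rw; rewrite nth1 ?nth2.
- move=> [//|r] rw; rewrite !nth2//; last exact: ltnW.
  by have := (sortedP (0, 0)%N srt) r rw; rewrite /lexle; lia.
- move=> [//|r] rw; rewrite !nth2 ?nth1//; try exact: ltnW.
  by have := (sortedP (0, 0)%N srt) r rw; rewrite /lexle; lia.
- exact/(run w srt).
Qed.

End AdmissibleWords.

(** * The vectors of D *)

Section BasisWords.
Variables (R : realType) (K G : hilbertType R) (d : nat -> K) (e : nat -> G).
Hypothesis hd : orthonormal_basis [set i : nat | (1 <= i)%N] d.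
Hypothesis he : orthonormal_basis [set k : nat | (1 <= k)%N] e.
Variables (H : hilbert_tensor K G) (FH : full_fock H) (Gam : sym_fock FH).

Let letter (p : nat * nat) : K * nat := (d p.1.+1, p.2).

Let bvec (p : nat * nat) : H := vec e H (letter p).

Let bword (w : seq (nat * nat)) : Gam := word_vec e Gam (map letter w).

Lemma tens_bounded_l g : bounded_by `|g| (fun f => tens H f g).
Proof.
split=> // [c u v|f].
  apply: (eq_inner_total (tens_total H)) => _ [[f' g'] _ <-] /=.
  by rewrite inner_linear !tens_inner inner_linear mulrDl mulrA.
rewrite -(@ler_pXn2r _ 2) ?nnegrE ?mulr_ge0// exprMn -!inner_norm.
by rewrite tens_inner mulrC.
Qed.

Lemma tens_bounded_r f : bounded_by `|f| (tens H f).
Proof.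
split=> // [c u v|g].
  apply: (eq_inner_total (tens_total H)) => _ [[f' g'] _ <-] /=.
  by rewrite inner_linear !tens_inner inner_linear mulrDr mulrCA.
rewrite -(@ler_pXn2r _ 2) ?nnegrE ?mulr_ge0// exprMn -!inner_norm.
by rewrite tens_inner.
Qed.

(** Expand the first factor of a tensor product, then the second one. *)
Lemma bvec_total : closed_span (range bvec) = setT.
Proof.
have cS := closed_span_subspace (range bvec).
apply: (total_sub (tens_total H)) => _ [[f g] _ <-] /=.
move: f; apply: (total_ind hd.2 (closed_subspace_preimage (tens_bounded_l g) cS)).
move=> _ [[|i] // _ <-] /=.
move: g; apply: (total_ind he.2 (closed_subspace_preimage (tens_bounded_r (d i.+1)) cS)).
by move=> _ [[|k] // _ <-] /=; apply: sub_closed_span; exists (i, k).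
Qed.

Lemma vec_total : closed_span (range (vec e H)) = setT.
Proof.
apply: (total_sub bvec_total) => _ [p _ <-].
by apply: sub_closed_span; exists (letter p).
Qed.

Lemma bword_total : closed_span (range bword) = setT.
Proof.
have -> : bword = (fun w => nsym Gam (map bvec w)).
  by apply/funext => w; rewrite /bword /word_vec -map_comp.
exact: nsym_map_total bvec_total.
Qed.

Lemma bvec_inner p q : ⟨bvec p, bvec q⟩ = (p == q)%:R.
Proof.
rewrite (vec_inner he) hd.1// /= eqSS -natrM mulnb.
by case: p q => [a b] [a' b'].
Qed.

Lemma bword_orth w w' : ~~ perm_eq w w' -> ⟨bword w, bword w'⟩ = 0.
Proof.
rewrite /bword /word_vec -!map_comp => ww'.
apply: (@nsym_orth _ _ _ _ _ _ _ id); last by rewrite !map_id.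
by move=> p q pq; rewrite bvec_inner (negPf pq).
Qed.

(** All terms of the permanent are 0 or 1, and the identity contributes 1. *)
Lemma bword_norm w : 0 < ⟨bword w, bword w⟩.
Proof.
rewrite /bword /word_vec -!map_comp.
rewrite (@nsym_inner _ _ _ _ (size w)) ?size_map//.
have term (s : 'S_(size w)) : \prod_(i < size w)
    ⟨(map bvec w)`_i, (map bvec w)`_(s i)⟩ =
    (\prod_(i < size w) (nth (0, 0)%N w i == nth (0, 0)%N w (s i)))%:R.
  rewrite natr_prod; apply: eq_bigr => i _.
  by rewrite !(nth_map (0, 0)%N) ?bvec_inner.
rewrite (eq_bigr _ (fun s _ => term s)) (bigD1 (1%g : 'S_(size w)))//= ltr_wpDr//.
  by apply: sumr_ge0 => s _; rewrite ler0n.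
rewrite ltr0n big1// => i _; by rewrite perm1 eqxx.
Qed.

Lemma bword_norm_neq0 w : `|bword w| != 0.
Proof.
by apply/eqP => w0; have := bword_norm w; rewrite inner_norm w0 expr0n ltxx.
Qed.

Lemma bword_perm w w' : perm_eq w w' -> bword w = bword w'.
Proof. by move=> p; apply: word_vec_perm; exact: perm_map. Qed.

Lemma keys_letter w : unzip2 (map letter w) = unzip2 w.
Proof. by rewrite /unzip2 -map_comp. Qed.

Lemma normalizeZ (V : hilbertType R) (a : R[i]) (v : V) : 0 < a ->
  `|a *: v|^-1 *: (a *: v) = `|v|^-1 *: v.
Proof.
move=> a0; rewrite normrZ gtr0_norm// scalerA invfM mulrAC mulVf ?mul1r//.
by rewrite gt_eqF.
Qed.

Lemma DsetP x : Dset d e Gam x <->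
  exists w, [/\ sorted lexle w, irreducible (unzip2 w) & x = `|bword w|^-1 *: bword w].
Proof.
have E w : `|bword w|^-1 *: bword w =
    `|sfock_sym Gam [seq tens H (d p.1) (e p.2) | p <- shift_up w]|^-1 *:
      sfock_sym Gam [seq tens H (d p.1) (e p.2) | p <- shift_up w].
  by rewrite -map_comp /bword /word_vec -map_comp /nsym normalizeZ// sqrt_fact_gt0.
split.
  move=> [_ [s adm <-] <-]; have [w [-> srt irr]] := (admissibleP s).1 adm.
  by exists w; rewrite E.
move=> [w [srt irr ->]]; rewrite E.
exists (sfock_sym Gam [seq tens H (d p.1) (e p.2) | p <- shift_up w]) => //.
by exists (shift_up w) => //; apply: (admissibleP (shift_up w)).2; exists w.
Qed.

Lemma Dset_wandering x : Dset d e Gam x -> wandering (free_cr e Gam) x.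
Proof.
move=> /DsetP[w [_ irr ->]]; split.
  rewrite innerZl innerZr conj_Creal ?rpredV ?normr_real// mulrA -expr2.
  have n0 := bword_norm_neq0 w.
  by rewrite inner_norm -exprMn mulVf ?expr1n.
move=> f v; rewrite innerZl (irreducible_orth he vec_total) ?mulr0//.
by rewrite keys_letter.
Qed.

(** Distinct sorted words are not permutations of each other. *)
Lemma Dset_orth x y : Dset d e Gam x -> Dset d e Gam y -> x <> y -> ⟨x, y⟩ = 0.
Proof.
move=> /DsetP[w [sw _ ->]] /DsetP[w' [sw' _ ->]] xy.
rewrite innerZl innerZr bword_orth ?mulr0//; apply/negP => p; apply: xy.
by rewrite (sorted_eq lexle_trans lexle_anti sw sw' p).
Qed.

(** Induction on the length: a reducible word comes from a shorter one by a
    creation operator, which preserves the span in question; an irreducible one is,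
    once sorted, a multiple of a vector of [D]. *)
Lemma Dset_words_total :
  closed_span [set foldr (free_cr e Gam) x fs | x in Dset d e Gam & fs in setT] = setT.
Proof.
set T := [set _ | _ in _ & _ in _]; have cT := closed_span_subspace T.
have T_inv f v : closed_span T v -> closed_span T (free_cr e Gam f v).
  have [[c bc] _] := free_crP he Gam vec_total f.
  apply: (closed_span_sub (closed_subspace_preimage bc cT)).
  move=> _ [x Dx [fs _ <-]] /=; apply: sub_closed_span.
  by exists x => //; exists (f :: fs).
apply: (total_sub bword_total) => _ [w _ <-].
have [n] := ubnP (size w); elim: n w => // n IH w wn.
have [irr|/reducible_perm[i [w' ww']]] := pselect (irreducible (unzip2 w)).
  have p := permEl (perm_sort lexle w).
  set w1 := sort lexle w in p.
  have D1 : Dset d e Gam (`|bword w1|^-1 *: bword w1).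
    apply/DsetP; exists w1; split=> //; first exact: sort_sorted lexle_total _.
    move=> ks; apply: contraNN (irr ks) => /(perm_trans _); apply.
    by rewrite perm_sym; exact: perm_map.
  have n0 := bword_norm_neq0 w1.
  rewrite -(bword_perm p) -[bword w1]scale1r -(mulfV n0) -scalerA.
  apply: (closed_subspaceZ _ cT); apply: sub_closed_span.
  by exists (`|bword w1|^-1 *: bword w1) => //; exists [::].
rewrite (bword_perm ww').
have [_ hL] := free_crP he Gam vec_total (d i.+1).
have -> : bword ((i, top (unzip2 w')) :: w') = free_cr e Gam (d i.+1) (bword w').
  by rewrite hL /word_top keys_letter.
by apply/T_inv/IH; move: wn; rewrite (perm_size ww').
Qed.

End BasisWords.

Theorem theorem9p8 (R : realType)
    (K : L2Rplus R) (d : nat -> K)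
    (hd : orthonormal_basis [set i : nat | (1 <= i)%N]%classic d)
    (G : hilbertType R) (e : nat -> G)
    (he : orthonormal_basis [set k : nat | (1 <= k)%N]%classic e)
    (H : hilbert_tensor K G) (FH : full_fock H) (Gam : sym_fock FH)
    (FK : full_fock K)
    (rho : (Gam -> Gam) -> FK -> FK) (hrho : free_fock_rep e rho) :
  let C := algC e Gam in
  let D := Dset d e Gam in
  [/\ direct_sum D (cyclic_space C),
      forall x, D x -> unitarily_isomorphic (cyclic_space C x) [set: FK]%classic,
      rep_direct_sum C (@pi_def Gam) D (cyclic_space C) (pi_cyc C) &
      forall x, D x ->
        unitarily_equivalent C (cyclic_space C x) (pi_cyc C x)
          [set: FK]%classic rho].
Proof.
have [rho_rep rho_cr _] := hrho; have tot := vec_total hd he H.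
apply: wold_decomposition => //.
- by move=> f; have [] := free_crP he Gam tot f.
- exact: free_cr_inner.
- exact: free_cr_adjoint.
- exact: Dset_wandering.
- exact: Dset_orth.
- exact: Dset_words_total.
Qed.
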